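(* Let $k$ be a non-archimedean local field and let $(M_A,N_A)$ be a relevant pair of A-parameters for $\mathrm{GL}_m(k)\times \mathrm{GL}_n(k)$, with associated pair of L-parameters $(M,N)$. Then the order of pole at $s=0$ of $$L(M,N,s)=\frac{L(M\otimes N^\vee,s+\tfrac12)\cdot L(M^\vee\otimes N,s+\tfrac12)}{L(M\otimes M^\vee,s+1)\cdot L(N\otimes N^\vee,s+1)}$$ is greater than or equal to zero (i.e. $L(M,N,s)$ does not vanish at $s=0$).
   Context: $W(k)$ is the Weil group of $k$ and $WD(k)=W(k)\times \mathrm{SL}_2(\mathbb C)$ the Weil-Deligne group. An A-parameter for $\mathrm{GL}_m(k)$ is an $m$-dimensional complex representation $M_A$ of $WD(k)\times \mathrm{SL}_2(\mathbb C)$ whose restriction to $WD(k)$ is admissible with bounded image on $W(k)$ and whose restriction to the last factor $\mathrm{SL}_2(\mathbb C)$ is algebraic. It has a canonical decomposition $M_A=\bigoplus_{i\ge 0} M_i\otimes \mathrm{Sym}^i(\mathbb C^2)$ with $M_i$ bounded admissible representations of $WD(k)$. Its associated L-parameter $M$ is the representation of $WD(k)$ obtained by composing $M_A$ with $w\mapsto (w,\mathrm{diag}(|w|^{1/2},|w|^{-1/2}))$. Two A-parameters $M_A=\bigoplus_i M_i\otimes \mathrm{Sym}^i(\mathbb C^2)$ and $N_A=\bigoplus_i N_i\otimes \mathrm{Sym}^i(\mathbb C^2)$ form a relevant pair if there are decompositions of $WD(k)$-representations $M_i= M_i^+\oplus M_i^-$ and $N_i= N_i^+\oplus N_i^-$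 such that $M_i^+\cong N_{i+1}^-$ for all $i\ge 0$ and $M_i^-\cong N_{i-1}^+$ for all $i\ge 1$ (so $M_0^-$ and $N_0^-$ are unconstrained). $L(\cdot,s)$ denotes the usual L-function of a representation of $WD(k)$, and $\vee$ the contragredient. The order of pole is the negative of the order of vanishing. *)

(* Defs.v *)
From HB Require Import structures.
From mathcomp Require Import all_boot all_order all_algebra all_field.
From mathcomp Require Import mxtens complex zify ring.
From mathcomp Require mpoly.
From mathcomp Require Import all_classical all_reals all_analysis.

Set Implicit Arguments.
Unset Strict Implicit.
Unset Printing Implicit Defensive.

Import Order.TTheory GRing.Theory Num.Theory numFieldNormedType.Exports.
Local Open Scope classical_set_scope.
Local Open Scope ring_scope.

(* A discrete valuation [v] is an integer-valued function that is meaningful on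
   nonzero elements only, with [v 0] standing for [+oo]. *)
Definition val_ge (k : fieldType) (v : k -> int) (N : int) (x : k) : bool :=
  (x == 0) || (N <= v x).

(* A field which is complete for a normalized discrete valuation and has a
   finite residue field; [lf_reps] is a system of representatives of the residue
   field, so that its size is the residue cardinality. *)
Record nonarch_local_field := NonarchLocalField {
  lf_sort :> fieldType;
  lf_val : lf_sort -> int;
  lf_valM : forall x y, x != 0 -> y != 0 -> lf_val (x * y) = lf_val x + lf_val y;
  lf_valD : forall N x y,
    val_ge lf_val N x -> val_ge lf_val N y -> val_ge lf_val N (x + y);
  lf_val_norm : exists2 x, x != 0 & lf_val x = 1;
  lf_complete : forall u : nat -> lf_sort,
    (forall N, exists n, forall i j, (n <= i)%N -> (n <= j)%N ->
       val_ge lf_val N (u i - u j)) ->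
    exists l, forall N, exists n, forall i, (n <= i)%N ->
       val_ge lf_val N (u i - l);
  lf_reps : seq lf_sort;
  lf_reps_int : forall x, x \in lf_reps -> val_ge lf_val 0 x;
  lf_repsP : forall x, val_ge lf_val 0 x ->
    count (fun r => val_ge lf_val 1 (x - r)) lf_reps = 1%N
}.

Definition resq (k : nonarch_local_field) : nat := size (lf_reps k).

Lemma resq_gt0 (k : nonarch_local_field) : (0 < resq k)%N.
Proof.
have := @lf_repsP k 0; rewrite /val_ge eqxx => /(_ isT).
by rewrite /resq; case: (lf_reps k).
Qed.

Definition lf_int (k : nonarch_local_field) : {pred k} :=
  [pred x | val_ge (@lf_val k) 0 x].
Arguments lf_int : clear implicits.

Lemma lf_val1 (k : nonarch_local_field) : lf_val (1 : k) = 0.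
Proof.
by apply: (addrI (lf_val (1 : k))); rewrite -lf_valM ?oner_eq0// mulr1 addr0.
Qed.

Lemma lf_valN1 (k : nonarch_local_field) : lf_val (-1 : k) = 0.
Proof.
have := @lf_valM k (-1) (-1); rewrite mulN1r opprK lf_val1 oppr_eq0 oner_eq0.
by move=> /(_ isT isT); lia.
Qed.

Lemma val_geM (k : nonarch_local_field) (M N : int) (x y : k) :
  val_ge (@lf_val k) M x -> val_ge (@lf_val k) N y ->
  val_ge (@lf_val k) (M + N) (x * y).
Proof.
rewrite /val_ge mulf_eq0; have [//|x0 /=] := eqVneq x 0.
have [//|y0 /= Mx Ny] := eqVneq y 0.
by rewrite lf_valM// lerD.
Qed.

Lemma val_ge_closed (k : nonarch_local_field) : subring_closed (lf_int k).
Proof.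
have int1 : 1 \in lf_int k by rewrite inE /val_ge lf_val1 lexx orbT.
have intN1 : -1 \in lf_int k by rewrite inE /val_ge lf_valN1 lexx orbT.
split=> // x y; rewrite !inE => xi yi; last exact: (val_geM xi yi).
by apply: lf_valD => //; rewrite -mulN1r; exact: (val_geM intN1 yi).
Qed.

HB.instance Definition _ (k : nonarch_local_field) :=
  GRing.isSubringClosed.Build k (lf_int k) (@val_ge_closed k).

Section ValuationRing.
Variable k : nonarch_local_field.
Record valring := ValRing { valring_val : k; _ : valring_val \in lf_int k }.
HB.instance Definition _ := [isSub for valring_val].
HB.instance Definition _ := [Choice of valring by <:].
HB.instance Definition _ := [SubChoice_isSubComNzRing of valring by <:].
End ValuationRing.

Record separable_closure (k : fieldType) := SeparableClosure {
  sc_sort :> fieldType;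
  sc_emb : {rmorphism k -> sc_sort};
  sc_separable : forall x : sc_sort,
    exists2 p : {poly k}, separable_poly p & root (map_poly sc_emb p) x;
  sc_closed : forall p : {poly sc_sort}, separable_poly p -> (1 < size p)%N ->
    exists x, root p x
}.

Section Weil.
Variables (k : nonarch_local_field) (K : separable_closure k).

Definition is_galois (f : K -> K) : Prop :=
  [/\ zmod_morphism f, GRing.monoid_morphism f, bijective f &
      forall a : k, f (sc_emb K a) = sc_emb K a].

Definition valring_emb : {rmorphism valring k -> K} := (sc_emb K) \o val.

Definition sc_int (x : K) : Prop := integralOver valring_emb x.

(* The maximal ideal of the ring of integers of [K] (the elements of positive
   valuation) is the radical of the ideal generated by that of [k]. *)
Definition sc_max (x : K) : Prop :=
  exists n (p : k) (y : K),
    [/\ val_ge (@lf_val k) 1 p, sc_int y & x ^+ n.+1 = sc_emb K p * y].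

(* [f] induces on the residue field of [K] the [d]-th power of the arithmetic
   Frobenius automorphism [x |-> x ^+ q]. *)
Definition acts_as_frobenius (f : K -> K) (d : int) : Prop :=
  forall x, sc_int x ->
  match d with
  | Posz n => sc_max (f x - x ^+ (resq k ^ n))
  | Negz n => sc_max (f x ^+ (resq k ^ n.+1) - x)
  end.

(* The Weil group, as the fibre product over the Galois group of the residue
   field of the Galois group of [K / k] and of the integers. *)
Record weil := Weil {
  weil_fun :> K -> K;
  weil_deg : int;
  weil_galois : is_galois weil_fun;
  weil_frob : acts_as_frobenius weil_fun weil_deg
}.

Lemma weil_inj (w w' : weil) :
  weil_fun w =1 w' -> weil_deg w = weil_deg w' -> w = w'.
Proof.
case: w w' => f d P Q [f' d' P' Q'] /= /funext ff dd.
by case: _ / ff P' Q' => P' Q'; case: _ / dd Q' => Q'; congr Weil; exact: Prop_irrelevance.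
Qed.

HB.instance Definition _ := gen_eqMixin weil.
HB.instance Definition _ := gen_choiceMixin weil.

Lemma is_galois_id : is_galois id.
Proof. by split=> //; exists id. Qed.

Lemma is_galois_comp f g : is_galois f -> is_galois g -> is_galois (f \o g).
Proof.
move=> [fB [f1 fM] fb fk] [gB [g1 gM] gb gk]; split=> [x y||| a] /=.
- by rewrite gB fB.
- by split=> [|x y] /=; rewrite ?g1 ?gM ?fM.
- exact: bij_comp.
- by rewrite gk fk.
Qed.

Lemma is_galois_can f g :
  is_galois f -> cancel f g -> cancel g f -> is_galois g.
Proof.
move=> [fB [f1 fM] fb fk] fK gK; split=> [x y||| a].
- by apply: (can_inj fK); rewrite fB !gK.
- split=> [|x y]; first by rewrite -f1 fK.
  by apply: (can_inj fK); rewrite fM !gK.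
- by exists f.
- by rewrite -{1}fk fK.
Qed.

Lemma sc_int0 : sc_int 0. Proof. exact: (mxpoly.integral0 valring_emb). Qed.
Lemma sc_int1 : sc_int 1. Proof. exact: (mxpoly.integral1 valring_emb). Qed.

Lemma sc_intX x n : sc_int x -> sc_int (x ^+ n).
Proof.
move=> xi; elim: n => [|n IHn]; first exact: sc_int1.
by rewrite exprS; apply: integral_mul.
Qed.

Lemma sc_max_mul x y : sc_max x -> sc_int y -> sc_max (x * y).
Proof.
move=> [n [p [z [p1 zi xE]]]] yi; exists n, p, (z * y ^+ n.+1); split=> //.
  by apply: integral_mul => //; apply: sc_intX.
by rewrite exprMn xE mulrA.
Qed.

Lemma sc_max_add x y : sc_int x -> sc_int y ->
  sc_max x -> sc_max y -> sc_max (x + y).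
Proof.
move=> xi yi [n [p [z [p1 zi xE]]]] [m [r [t [r1 ti yE]]]].
wlog [c ci rE] : x y xi yi n m p r z t p1 r1 zi ti xE yE /
    exists2 c : k, c \in lf_int k & r = p * c.
  move=> H; case: (eqVneq p 0) => [p0|p0].
    rewrite addrC; apply: (H y x yi xi m n r p t z) => //.
    by exists 0; rewrite ?inE /val_ge ?eqxx// mulr0.
  case: (eqVneq r 0) => [r0|r0].
    apply: (H x y xi yi n m p r z t) => //.
    by exists 0; rewrite ?inE /val_ge ?eqxx// mulr0.
  have div (a b : k) : a != 0 -> b != 0 -> lf_val a <= lf_val b ->
      exists2 c : k, c \in lf_int k & b = a * c.
    move=> a0 b0 ab; exists (b / a); last by rewrite mulrC divfK.
    rewrite inE /val_ge; apply/orP; right.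
    have ba0 : b / a != 0 by rewrite mulf_neq0 ?invr_eq0.
    by have := lf_valM ba0 a0; rewrite divfK//; lia.
  have [pr|/ltW rp] := leP (lf_val p) (lf_val r).
    by apply: (H x y xi yi n m p r z t) => //; apply: div.
  by rewrite addrC; apply: (H y x yi xi m n r p t z) => //; apply: div.
have ci' : sc_int (sc_emb K c) by have := integral_id valring_emb (ValRing ci).
exists (n + m).+1, p.
pose I (u : K) := exists2 w, sc_int w & u = sc_emb K p * w.
suff [w wi wE] : I ((x + y) ^+ (n + m).+2) by exists w.
have I0 : I 0 by exists 0; rewrite ?mulr0//; exact: sc_int0.
have IM u v : I u -> sc_int v -> I (u * v).
  move=> [w wi ->] vi; exists (w * v); last by rewrite mulrA.
  exact: integral_mul.
have ID u v : I u -> I v -> I (u + v).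
  move=> [w wi ->] [w' wi' ->]; exists (w + w'); last by rewrite mulrDr.
  exact: integral_add.
rewrite exprDn; apply: (big_ind I) => // i _.
rewrite -mulr_natr; apply: (IM); last exact: integral_nat.
have [im|mi] := leqP i m.
  have -> : ((n + m).+2 - i = n.+1 + (m.+1 - i))%N by lia.
  rewrite exprD -mulrA; apply: (IM); first by exists z.
  by apply: integral_mul; apply: sc_intX.
rewrite -(subnKC mi) exprD mulrCA; apply: (IM).
  by exists (sc_emb K c * t); [exact: integral_mul | rewrite yE rE rmorphM mulrA].
by apply: integral_mul; apply: sc_intX.
Qed.

Definition sc_cong (x y : K) : Prop := [/\ sc_int x, sc_int y & sc_max (x - y)].

Lemma sc_cong_trans y x z : sc_cong x y -> sc_cong y z -> sc_cong x z.
Proof.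
move=> [xi yi xy] [_ zi yz]; split=> //.
by rewrite -(subrKA y); apply: sc_max_add => //; apply: integral_sub.
Qed.

Lemma sc_cong_sym x y : sc_cong x y -> sc_cong y x.
Proof.
move=> [xi yi xy]; split=> //; rewrite -opprB -mulN1r mulrC.
by apply: sc_max_mul => //; apply: integral_opp; exact: sc_int1.
Qed.

Lemma sc_congX n x y : sc_cong x y -> sc_cong (x ^+ n) (y ^+ n).
Proof.
move=> [xi yi xy]; split; [exact: sc_intX|exact: sc_intX|].
rewrite subrXX; apply: sc_max_mul => //.
apply: (big_ind sc_int) => [|u v ui vi|i _]; first exact: sc_int0.
  exact: integral_add.
by apply: integral_mul; apply: sc_intX.
Qed.

Lemma galois_int f x : is_galois f -> sc_int x -> sc_int (f x).
Proof.
move=> [fB fM _ fk] [p p_mon px]; exists p => //.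
pose F0 := GRing.isZmodMorphism.Build K K f fB.
pose F1 := GRing.isMonoidMorphism.Build K K f fM.
pose F : {rmorphism K -> K} := HB.pack f F0 F1.
have Fpx : (map_poly F (map_poly valring_emb p)).[F x] = 0.
  by rewrite horner_map (rootP px) rmorph0.
apply/rootP; rewrite -[RHS]Fpx; congr horner.
by apply/polyP => i; rewrite !coef_map /= fk.
Qed.

Lemma galois_cong f x y :
  is_galois f -> sc_cong x y -> sc_cong (f x) (f y).
Proof.
move=> fG [xi yi [n [p [z [p1 zi xE]]]]].
have fi := galois_int fG; split; [exact: fi|exact: fi|].
case: (fG) => fB [f1 fM] _ fk; exists n, p, (f z); split=> //; first exact: fi.
rewrite -fB -[in RHS]fk -fM -xE.
by elim: n.+1 => [|j IHj]; rewrite ?expr0 ?f1// !exprS fM IHj.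
Qed.

Lemma frobeniusE f d : is_galois f -> acts_as_frobenius f d <->
  forall x, sc_int x -> match d with
  | Posz n => sc_cong (f x) (x ^+ (resq k ^ n))
  | Negz n => sc_cong (f x ^+ (resq k ^ n.+1)) x
  end.
Proof.
move=> fG; split=> fF x xi; have := fF x xi; have := galois_int fG xi;
  case: d {fF} => n fi; try by case.
- by split=> //; apply: sc_intX.
- by split=> //; apply: sc_intX.
Qed.

(* A form of the Frobenius condition which is additive in the exponent. *)
Lemma frobeniusP f d : is_galois f -> acts_as_frobenius f d <->
  exists a b : nat, d = Posz b - Posz a /\
    (a = 0%N \/ b = 0%N) /\
    forall x, sc_int x -> sc_cong (f x ^+ (resq k ^ a)) (x ^+ (resq k ^ b)).
Proof.
move=> fG; rewrite frobeniusE//; split.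
  case: d => n fF.
    by exists 0%N, n; split; [lia|split; [left|]] => // x xi; exact: fF.
  by exists n.+1, 0%N; split; [lia|split; [right|]] => // x xi; exact: fF.
move=> [a [b [-> [[->|->]]]]].
  by rewrite subr0 => H x xi; have := H x xi; rewrite expn0 expr1.
rewrite sub0r; case: a => [|a] H x xi; have := H x xi.
  by rewrite oppr0 !expn0.
by rewrite -NegzE.
Qed.

Lemma frobenius_comp f g d e : is_galois f -> is_galois g ->
  acts_as_frobenius f d -> acts_as_frobenius g e ->
  acts_as_frobenius (f \o g) (d + e).
Proof.
move=> fG gG /(frobeniusP _ fG)[a [b [-> [ab fF]]]].
move=> /(frobeniusP _ gG)[a' [b' [-> [ab' gF]]]].
apply/(frobeniusP _ (is_galois_comp fG gG)).
pose A := (a + a' - (b + b'))%N; pose B := (b + b' - (a + a'))%N.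
exists A, B; split; first by rewrite /A /B; lia.
split; first by rewrite /A /B; lia.
move=> x xi /=.
have gi := galois_int gG xi.
have fX u j : f (u ^+ j) = f u ^+ j.
  by case: fG => _ [f1 fM] _ _; elim: j => [|j IHj]; rewrite ?expr0 ?f1// !exprS fM IHj.
have gxF := gF x xi.
have fgF := fF _ gi.
have fgF' : sc_cong (f (g x) ^+ (resq k ^ a')) (f x ^+ (resq k ^ b')).
  by rewrite -!fX; exact: galois_cong.
have fxF := fF _ xi.
have P u v j : sc_cong u v -> sc_cong (u ^+ (resq k ^ j)) (v ^+ (resq k ^ j)).
  exact: sc_congX.
have Xadd (u : K) i j : u ^+ (resq k ^ (i + j)) = (u ^+ (resq k ^ i)) ^+ (resq k ^ j).
  by rewrite expnD exprM.
have X0 (u : K) : u ^+ (resq k ^ 0) = u by rewrite expn0 expr1.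
case: ab => [a0|b0]; case: ab' => [a'0|b'0].
- have -> : A = 0%N by rewrite /A; lia.
  have -> : B = (b' + b)%N by rewrite /B; lia.
  rewrite X0 Xadd; apply: sc_cong_trans (P _ _ b _).
    by move: fgF; rewrite a0 X0; exact.
  by move: gxF; rewrite a'0 X0.
- have [le|lt] := leqP a' b.
    have -> : A = 0%N by rewrite /A; lia.
    have -> : B = (b - a')%N by rewrite /B; lia.
    rewrite X0; apply: (sc_cong_trans (y := g x ^+ (resq k ^ b))).
      by move: fgF; rewrite a0 X0.
    rewrite -{1}(subnKC le) Xadd; apply: P.
    by move: gxF; rewrite b'0 X0.
  have -> : A = (a' - b)%N by rewrite /A; lia.
  have -> : B = 0%N by rewrite /B; lia.
  rewrite X0; apply: (sc_cong_trans (y := g x ^+ (resq k ^ (b + (a' - b))))).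
    by rewrite Xadd; apply: P; move: fgF; rewrite a0 X0.
  by move: gxF; rewrite subnKC 1?ltnW// b'0 X0.
- have [le|lt] := leqP a b'.
    have -> : A = 0%N by rewrite /A; lia.
    have -> : B = (b' - a)%N by rewrite /B; lia.
    rewrite X0; apply: (sc_cong_trans (y := f x ^+ (resq k ^ b'))).
      by move: fgF'; rewrite a'0 X0.
    rewrite -{1}(subnKC le) Xadd; apply: P.
    by move: fxF; rewrite b0 X0.
  have -> : A = (a - b')%N by rewrite /A; lia.
  have -> : B = 0%N by rewrite /B; lia.
  rewrite X0; apply: (sc_cong_trans (y := f x ^+ (resq k ^ (b' + (a - b'))))).
    by rewrite Xadd; apply: P; move: fgF'; rewrite a'0 X0.
  by move: fxF; rewrite subnKC 1?ltnW// b0 X0.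
- have -> : A = (a + a')%N by rewrite /A; lia.
  have -> : B = 0%N by rewrite /B; lia.
  rewrite X0 Xadd; apply: (sc_cong_trans (y := g x ^+ (resq k ^ a'))).
    by apply: P; move: fgF; rewrite b0 X0.
  by move: gxF; rewrite b'0 X0.
Qed.

Lemma frobenius_can f g d : is_galois f -> cancel f g -> cancel g f ->
  acts_as_frobenius f d -> acts_as_frobenius g (- d).
Proof.
move=> fG fK gK /(frobeniusP _ fG)[a [b [-> [ab fF]]]].
have gG := is_galois_can fG fK gK.
apply/(frobeniusP _ gG); exists b, a; split; first by lia.
split; first by case: ab; [right|left].
move=> x xi; have := fF _ (galois_int gG xi).
by rewrite gK => /sc_cong_sym.
Qed.

Definition weil_one : weil.
Proof.
refine (@Weil id 0 is_galois_id _) => x xi.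
rewrite /= expn0 expr1 subrr; exists 0%N, 0, 0.
by rewrite /val_ge eqxx rmorph0 mulr0 expr1; split=> //; exact: sc_int0.
Defined.

Definition weil_mul (w w' : weil) : weil :=
  Weil (is_galois_comp (weil_galois w) (weil_galois w'))
    (frobenius_comp (weil_galois w) (weil_galois w')
       (weil_frob w) (weil_frob w')).

Lemma weil_surj (w : weil) (y : K) : exists x, w x == y.
Proof.
by have [_ _ [g _ gK] _] := weil_galois w; exists (g y); rewrite gK.
Qed.

Definition weil_invfun (w : weil) (y : K) : K := xchoose (weil_surj w y).

Lemma weil_invfunK (w : weil) : cancel (weil_invfun w) w.
Proof. by move=> y; apply/eqP; exact: (xchooseP (weil_surj w y)). Qed.

Lemma weil_funK (w : weil) : cancel w (weil_invfun w).
Proof.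
move=> x; have [_ _ wb _] := weil_galois w; apply: (bij_inj wb).
exact: weil_invfunK.
Qed.

Definition weil_inv (w : weil) : weil :=
  Weil (is_galois_can (weil_galois w) (weil_funK w) (weil_invfunK w))
    (frobenius_can (weil_galois w) (weil_funK w) (weil_invfunK w)
       (weil_frob w)).

Lemma weil_mulA : associative weil_mul.
Proof. by move=> u v w; apply: weil_inj => //=; rewrite addrA. Qed.

Lemma weil_mul1 : left_id weil_one weil_mul.
Proof. by move=> w; apply: weil_inj => //=; rewrite add0r. Qed.

Lemma weil_mulr1 : right_id weil_one weil_mul.
Proof. by move=> w; apply: weil_inj => //=; rewrite addr0. Qed.

Lemma weil_mulV : left_inverse weil_one weil_inv weil_mul.
Proof.
by move=> w; apply: weil_inj => [x|] /=; rewrite ?weil_funK ?addNr.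
Qed.

Lemma weil_mulrV : right_inverse weil_one weil_inv weil_mul.
Proof.
by move=> w; apply: weil_inj => [x|] /=; rewrite ?weil_invfunK ?subrr.
Qed.

HB.instance Definition _ := isGroup.Build weil
  weil_mulA weil_mul1 weil_mulr1 weil_mulV weil_mulrV.

End Weil.

Record rep (F : fieldType) (G : groupType) := Rep {
  rep_dim : nat;
  rep_mx :> G -> 'M[F]_rep_dim;
  rep_mx1 : rep_mx 1%g = 1%:M;
  rep_mxM : forall g h, rep_mx (g * h)%g = rep_mx g *m rep_mx h
}.

Section Representations.
Variable F : fieldType.

Section SameGroup.
Variable G : groupType.
Implicit Types V W : rep F G.

Definition rep_iso V W : Prop :=
  exists (P : 'M[F]_(rep_dim V, rep_dim W)) (Q : 'M[F]_(rep_dim W, rep_dim V)),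
    [/\ P *m Q = 1%:M, Q *m P = 1%:M & forall g, V g *m P = P *m W g].

Program Definition rep_dsum V W : rep F G :=
  @Rep F G (rep_dim V + rep_dim W) (fun g => block_mx (V g) 0 0 (W g)) _ _.
Next Obligation. by move=> V W; rewrite /= !rep_mx1 -scalar_mx_block. Qed.
Next Obligation.
move=> V W g h; rewrite /= mulmx_block !rep_mxM.
by rewrite !mulmx0 !mul0mx !addr0 add0r.
Qed.

Program Definition rep_bigsum (d : nat) (V : nat -> rep F G) : rep F G :=
  @Rep F G (\sum_(i < d) rep_dim (V i)) (fun g => \mxdiag_(i < d) V i g) _ _.
Next Obligation.
move=> d V /=; rewrite -mxdiagZ; apply: eq_mxdiag => i; exact: rep_mx1.
Qed.
Next Obligation.
move=> d V g h /=; rewrite {2}/mxdiag mul_mxblock_mxdiag.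
apply/eq_mxblock => i j; have [<-|ij] := eqVneq i j.
  by rewrite !conform_mx_id rep_mxM.
by rewrite mul0mx.
Qed.

Program Definition rep_tens V W : rep F G :=
  @Rep F G (rep_dim V * rep_dim W) (fun g => V g *t W g) _ _.
Next Obligation.
move=> V W /=; rewrite !rep_mx1; apply/matrixP => i j.
case: (mxtens_indexP i) => i0 i1; case: (mxtens_indexP j) => j0 j1.
rewrite tensmxE !mxE (inj_eq (can_inj (@mxtens_indexK _ _))) xpair_eqE.
by case: (i0 == j0); case: (i1 == j1); rewrite ?mulr1 ?mulr0 ?mul0r.
Qed.
Next Obligation. by move=> V W g h; rewrite /= tensmx_mul !rep_mxM. Qed.

Program Definition rep_dual V : rep F G :=
  @Rep F G (rep_dim V) (fun g => (V g^-1%g)^T) _ _.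
Next Obligation. by move=> V; rewrite /= invg1 rep_mx1 trmx1. Qed.
Next Obligation. by move=> V g h; rewrite /= invgM rep_mxM trmx_mul. Qed.

End SameGroup.

Program Definition rep_pull (G H : groupType) (f : G -> H)
    (fM : monoid.monoid_morphism f) (V : rep F H) : rep F G :=
  @Rep F G (rep_dim V) (fun g => V (f g)) _ _.
Next Obligation. by move=> G H f [f1 _] V; rewrite /= f1 rep_mx1. Qed.
Next Obligation. by move=> G H f [_ fM] V g h; rewrite /= fM rep_mxM. Qed.

End Representations.

Section SpecialLinear.
Variable F : fieldType.

Record sl2 := SL2 { sl2_mx :> 'M[F]_2; _ : \det sl2_mx == 1 }.
HB.instance Definition _ := [isSub for sl2_mx].
HB.instance Definition _ := [Choice of sl2 by <:].

Lemma sl2_det (g : sl2) : \det g = 1.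
Proof. by apply/eqP; case: g. Qed.

Lemma sl2_unit (g : sl2) : sl2_mx g \in unitmx.
Proof. by rewrite unitmxE sl2_det unitr1. Qed.

Lemma sl2_det_one : \det (1%:M : 'M[F]_2) == 1.
Proof. by rewrite det1. Qed.

Lemma sl2_det_mul (g h : sl2) : \det (g *m h) == 1.
Proof. by rewrite det_mulmx !sl2_det mulr1. Qed.

Lemma sl2_det_inv (g : sl2) : \det (invmx g) == 1.
Proof. by rewrite det_inv sl2_det invr1. Qed.

Definition sl2_one := SL2 sl2_det_one.
Definition sl2_mul g h := SL2 (sl2_det_mul g h).
Definition sl2_inv g := SL2 (sl2_det_inv g).

Lemma sl2_mulA : associative sl2_mul.
Proof. by move=> f g h; apply: val_inj; exact: mulmxA. Qed.

Lemma sl2_mul1 : left_id sl2_one sl2_mul.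
Proof. by move=> g; apply: val_inj; exact: mul1mx. Qed.

Lemma sl2_mulr1 : right_id sl2_one sl2_mul.
Proof. by move=> g; apply: val_inj; exact: mulmx1. Qed.

Lemma sl2_mulV : left_inverse sl2_one sl2_inv sl2_mul.
Proof. by move=> g; apply: val_inj; rewrite /= mulVmx// sl2_unit. Qed.

Lemma sl2_mulrV : right_inverse sl2_one sl2_inv sl2_mul.
Proof. by move=> g; apply: val_inj; rewrite /= mulmxV// sl2_unit. Qed.

HB.instance Definition _ := isGroup.Build sl2
  sl2_mulA sl2_mul1 sl2_mulr1 sl2_mulV sl2_mulrV.

Definition mx22 (a b c d : F) : 'M[F]_2 := \matrix_(i, j)
  if i == 0 then if j == 0 then a else b else if j == 0 then c else d.

Lemma det_mx22 a b c d : \det (mx22 a b c d) = a * d - b * c.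
Proof.
rewrite (expand_det_row _ 0) big_ord_recl big_ord1 /cofactor !det_mx11 !mxE /=.
by rewrite expr0 expr1 !mul1r mulN1r mulrN.
Qed.

Lemma torus_det (t : F) (t0 : t != 0) : \det (mx22 t 0 0 t^-1) == 1.
Proof. by rewrite det_mx22 mul0r subr0 divff. Qed.

Lemma unip_det (x : F) : \det (mx22 1 x 0 1) == 1.
Proof. by rewrite det_mx22 mulr0 subr0 mulr1. Qed.

Definition torus (t : F) (t0 : t != 0) : sl2 := SL2 (torus_det t0).
Definition unip (x : F) : sl2 := SL2 (unip_det x).

(* The action of [g] on [F e_0 + F e_1] sends [e_j] to
   [g 0 j *: e_0 + g 1 j *: e_1]; dehomogenizing by [e_0 = 1] and [e_1 = 'X],
   the basis vector [e_0 ^+ (d - j) * e_1 ^+ j] of the symmetric power becomes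
   ['X^j]. *)
Definition sl2_lin (g : sl2) (j : 'I_2) : {poly F} :=
  (g 0 j)%:P + g 1 j *: 'X.

Definition sym_mx (d : nat) (g : sl2) : 'M[F]_d.+1 :=
  \matrix_(i, j) (sl2_lin g 0 ^+ (d - j) * sl2_lin g 1 ^+ j)`_i.

Definition hom_eval (d : nat) (p u v : {poly F}) : {poly F} :=
  \sum_(j < d.+1) p`_j *: (u ^+ (d - j) * v ^+ j).

Lemma hom_evalS d (p u v : {poly F}) (a b : F) : (size p <= d.+1)%N ->
  hom_eval d.+1 ((a%:P + b *: 'X) * p) u v = (a *: u + b *: v) * hom_eval d p u v.
Proof.
move=> sp; rewrite /hom_eval [RHS]mulrDl !mulr_sumr.
under eq_bigr do rewrite mulrDl coefD coefCM -scalerAl coefZ coefXM scalerDl.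
rewrite big_split /=; congr (_ + _).
  rewrite big_ord_recr /= nth_default// mulr0 scale0r addr0.
  apply: eq_bigr => j _; rewrite -scalerAl -scalerAr scalerA mulrA -exprS.
  by rewrite subSn// -ltnS.
rewrite big_ord_recl /= mulr0 scale0r add0r; apply: eq_bigr => j _.
by rewrite -scalerAl -scalerAr scalerA mulrCA -exprS /bump /= add1n subSS.
Qed.

Lemma size_lin (a b : F) : (size (a%:P + b *: 'X)%R <= 2)%N.
Proof.
rewrite (leq_trans (size_polyD _ _))// geq_max.
rewrite (leq_trans (size_polyC_leq1 _))//=.
by rewrite (leq_trans (size_scale_leq _ _))// size_polyX.
Qed.

Lemma size_lin_exp (a b : F) n (p : {poly F}) m : (size p <= m.+1)%N ->
  (size ((a%:P + b *: 'X) ^+ n * p)%R <= (n + m).+1)%N.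
Proof.
move=> sp; elim: n => [|n IHn]; first by rewrite expr0 mul1r.
rewrite exprS -mulrA (leq_trans (size_polyMleq _ _))//.
by have := size_lin a b; lia.
Qed.

Lemma hom_eval_exp n m (p u v : {poly F}) (a b : F) : (size p <= m.+1)%N ->
  hom_eval (n + m) ((a%:P + b *: 'X) ^+ n * p) u v =
  (a *: u + b *: v) ^+ n * hom_eval m p u v.
Proof.
move=> sp; elim: n => [|n IHn]; first by rewrite !expr0 !mul1r.
rewrite exprS -mulrA hom_evalS; last exact: size_lin_exp.
by rewrite IHn mulrA -exprS.
Qed.

Lemma sl2_linM g h j :
  sl2_lin (g * h)%g j = h 0 j *: sl2_lin g 0 + h 1 j *: sl2_lin g 1.
Proof.
rewrite /sl2_lin /= !mxE !big_ord_recl !big_ord0 !addr0 /=.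
have -> : lift ord0 ord0 = 1 :> 'I_2 by apply: val_inj.
rewrite !scalerDr !scalerA -!mul_polyC !rmorphD !rmorphM /=.
ring.
Qed.

Lemma sym_mx1 d : sym_mx d 1%g = 1%:M.
Proof.
apply/matrixP => i j; rewrite !mxE /sl2_lin /= !mxE /=.
by rewrite scale0r addr0 add0r expr1n mul1r scale1r coefXn.
Qed.

Lemma sym_mxM d g h : sym_mx d (g * h)%g = sym_mx d g *m sym_mx d h.
Proof.
apply/matrixP => i j; rewrite !mxE !sl2_linM.
have jd : (j <= d)%N by rewrite -ltnS.
have E : hom_eval d (sl2_lin h 0 ^+ (d - j) * (sl2_lin h 1 ^+ j * 1))
    (sl2_lin g 0) (sl2_lin g 1) =
  (h 0 0 *: sl2_lin g 0 + h 1 0 *: sl2_lin g 1) ^+ (d - j) *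
  (h 0 1 *: sl2_lin g 0 + h 1 1 *: sl2_lin g 1) ^+ j.
  rewrite -{1}(subnK jd) hom_eval_exp; last first.
    by have := @size_lin_exp (h 0 1) (h 1 1) j 1 0; rewrite size_poly1 addn0; apply.
  congr (_ * _); rewrite -{1}[nat_of_ord j]addn0 hom_eval_exp ?size_poly1//.
  by rewrite /hom_eval big_ord1 coef1 scale1r !expr0 !mulr1.
rewrite -E mulr1 /hom_eval coef_sum; apply: eq_bigr => l _.
by rewrite !mxE coefZ mulrC.
Qed.

Definition rep_sym (d : nat) : rep F sl2 := Rep (sym_mx1 d) (@sym_mxM d).

End SpecialLinear.

Section WeilDeligne.
Variables (R : realType) (k : nonarch_local_field) (K : separable_closure k).
Local Notation C := R[i].
Local Notation W := (weil K).

Definition WD : groupType := (W * sl2 C)%type.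
(* The group whose representations are the A-parameters. *)
Definition WDA : groupType := (WD * sl2 C)%type.

(* The norm is normalized so that geometric Frobenius elements have norm
   [q^-1], which is the normalized absolute value of a uniformizer. *)
Definition weil_norm (w : W) : R := (resq k)%:R ^ weil_deg w.

Definition geometric_frobenius (w : W) : Prop := weil_deg w = -1.

Definition weil_sqrtnorm (w : W) : C := (Num.sqrt (weil_norm w))%:C%C.

Lemma resq_neq0 : (resq k)%:R != 0 :> R.
Proof. by rewrite pnatr_eq0 -lt0n resq_gt0. Qed.

Lemma weil_norm_gt0 w : 0 < weil_norm w.
Proof. by rewrite exprz_gt0 ?ltr0n ?resq_gt0. Qed.

Lemma weil_sqrtnorm_neq0 w : weil_sqrtnorm w != 0.
Proof.
rewrite /weil_sqrtnorm eq_complex /= eqxx andbT.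
by rewrite sqrtr_eq0 -ltNge weil_norm_gt0.
Qed.

Lemma weil_sqrtnormM w w' :
  weil_sqrtnorm (w * w')%g = weil_sqrtnorm w * weil_sqrtnorm w'.
Proof.
rewrite /weil_sqrtnorm -rmorphM -sqrtrM ?ltW ?weil_norm_gt0//.
by rewrite /weil_norm /= expfzDr// resq_neq0.
Qed.

Lemma weil_sqrtnorm1 : weil_sqrtnorm 1%g = 1.
Proof. by rewrite /weil_sqrtnorm /weil_norm /= expr0z sqrtr1. Qed.

Definition weil_torus (w : W) : sl2 C := torus (weil_sqrtnorm_neq0 w).

Lemma weil_torus_morph : monoid.monoid_morphism weil_torus.
Proof.
split=> [|w w']; apply: val_inj => /=; apply/matrixP => i j.
  rewrite !mxE weil_sqrtnorm1 invr1.
  by case: i => [[|[|//]] ?]; case: j => [[|[|//]] ?].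
rewrite !mxE !big_ord_recl big_ord0 !mxE /= weil_sqrtnormM invfM.
by case: i => [[|[|//]] ?]; case: j => [[|[|//]] ?]; rewrite /= ?(mul0r, mulr0, addr0, add0r).
Qed.

Definition algebraic_mx (n : nat) (f : sl2 C -> 'M[C]_n) : Prop :=
  forall i j, exists P : mpoly.mpoly (2 * 2) C,
    forall g, f g i j = mpoly.meval (fun l => mxvec g 0 l) P.

(* Smooth and Frobenius-semisimple on the Weil group, algebraic on [SL_2]. The
   open subgroups of the Weil group are those containing the inertia group of
   some finite extension of [k], generated here by [xs]. *)
Definition admissible (V : rep C WD) : Prop :=
  [/\ exists xs : seq K, forall w : W, weil_deg w = 0 ->
        (forall x, x \in xs -> w x = x) -> V (w, 1%g) = 1%:M,
      forall w : W, diagonalizable (V (w, 1%g)) &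
      algebraic_mx (fun g => V (1%g, g))].

Definition bounded (V : rep C WD) : Prop :=
  exists B : C, forall (w : W) i j, `|V (w, 1%g) i j| <= B.

Lemma pair1_morph (G H : groupType) :
  monoid.monoid_morphism (fun x : G => (x, 1%g) : (G * H)%type).
Proof. by split=> // x y; congr pair; rewrite /= mulg1. Qed.

Definition A_param (V : rep C WDA) : Prop :=
  let V0 := rep_pull (@pair1_morph WD (sl2 C)) V in
  [/\ admissible V0, bounded V0 & algebraic_mx (fun g => V (1%g, g))].

Lemma L_param_morph : monoid.monoid_morphism
  (fun x : WD => (x, weil_torus x.1) : WDA).
Proof.
have [t1 tM] := weil_torus_morph.
by split=> [|x y] /=; [rewrite t1 | rewrite tM].
Qed.

Definition L_param (V : rep C WDA) : rep C WD := rep_pull L_param_morph V.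

Lemma fst_morph (G H : groupType) :
  monoid.monoid_morphism (fst : (G * H)%type -> G).
Proof. by []. Qed.

Lemma snd_morph (G H : groupType) :
  monoid.monoid_morphism (snd : (G * H)%type -> H).
Proof. by []. Qed.

Definition rep_boxtimes (G H : groupType) (V : rep C G) (V' : rep C H) :
    rep C (G * H)%type :=
  rep_tens (rep_pull (@fst_morph G H) V) (rep_pull (@snd_morph G H) V').

(* [V] is the direct sum of the [M i * Sym^i], where almost all [M i] are 0. *)
Definition A_decomposition (V : rep C WDA) (M : nat -> rep C WD) : Prop :=
  (forall i, admissible (M i) /\ bounded (M i)) /\
  exists d, (forall i, (d <= i)%N -> rep_dim (M i) = 0%N) /\
    rep_iso V (rep_bigsum d (fun i => rep_boxtimes (M i) (rep_sym C i))).

Definition relevant_pair (V V' : rep C WDA) : Prop :=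
  exists M N : nat -> rep C WD,
    [/\ A_decomposition V M, A_decomposition V' N &
     exists Mp Mm Np Nm : nat -> rep C WD,
       [/\ forall i, rep_iso (M i) (rep_dsum (Mp i) (Mm i)),
           forall i, rep_iso (N i) (rep_dsum (Np i) (Nm i)),
           forall i, rep_iso (Mp i) (Nm i.+1) &
           forall i, rep_iso (Mm i.+1) (Np i)]].

Definition cexp (z : C) : C :=
  ((expR (complex.Re z) * cos (complex.Im z)) +i*
   (expR (complex.Re z) * sin (complex.Im z)))%C.

Definition q_pow (s : C) : C := cexp (s * (ln (resq k)%:R)%:C%C).

(* The vectors fixed by inertia and by the upper triangular unipotent subgroup
   of [SL_2], i.e. the inertia invariants in the kernel of the monodromy
   operator N, since [V (1, unip x) = exp (x N)]. Vectors are written as rows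
   for the use of [mxalgebra], whence the transposition. *)
Definition L_invariant (V : rep C WD) (v : 'rV[C]_(rep_dim V)) : Prop :=
  forall (w : W) (x : C), weil_deg w = 0 -> v *m (V (w, unip x))^T = v.

Definition L_invariants (V : rep C WD) : 'M[C]_(rep_dim V) :=
  xget 0 [set A | forall v, (v <= A)%MS <-> L_invariant v].

(* The Frobenius [Phi] acts through [w |-> (w, diag (|w|^(1/2), |w|^(-1/2)))],
   so that the tensor product of a representation of the Weil group with [Sym^n]
   has the L-function of the former shifted by [n / 2]. *)
Definition L_function (Phi : W) (V : rep C WD) (s : C) : C :=
  (\det (1%:M - q_pow (- s) *:
     restrictmx (L_invariants V) (V (Phi, weil_torus Phi))^T))^-1.

Definition L_pair (Phi : W) (M N : rep C WD) (s : C) : C :=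
  (L_function Phi (rep_tens M (rep_dual N)) (s + 2^-1) *
   L_function Phi (rep_tens (rep_dual M) N) (s + 2^-1)) /
  (L_function Phi (rep_tens M (rep_dual M)) (s + 1) *
   L_function Phi (rep_tens N (rep_dual N)) (s + 1)).

End WeilDeligne.

(* The meromorphic function [f] has a pole of order [r] at [a]; a zero of order
   [n] is a pole of order [- n]. *)
Definition pole_order (R : realType) (f : R[i] -> R[i]) (a : R[i]) (r : int) :=
  exists2 l : R[i], l != 0 &
    (fun s : R[i]^o => (s - a) ^ r * f s : R[i]^o) @ (a : R[i]^o)^' --> (l : R[i]^o).

(* Main.v *)
(* Idea of the proof. The order of the pole of [L(V, s)] at [s = t] is the
   multiplicity of [q ^ t] as an eigenvalue of the Frobenius acting on the
   [L_invariants] of [V], and this multiplicity is additive in [V]. Along the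
   geometric Frobenius an L-parameter is a sum of strings
   [X (|.|^((m - 1) / 2) + ... + |.|^((1 - m) / 2))] with [X] bounded, and
   relevance says that [M] and [N] are made of the same [X_l], in strings of
   lengths [m_l] and [n_l] that differ by one. Hence the order of pole is a sum
   over pairs [(l, l')] of terms that involve only the multiplicities [f c] of
   [q ^ (- c / 2)] for [X_l] tensored with the dual of [X_l']. Boundedness gives
   [f c = 0] for [c < 0], and each term is then nonnegative since
   [[m + 1] - x^(+-1) [m] = x^(-+m)], where [[m] = x^(m-1) + ... + x^(1-m)]. *)

Require Import Defs.
From mathcomp Require Import all_boot all_order all_algebra.
From mathcomp Require Import mxtens complex zify ring lra.
From mathcomp Require mpoly.
From mathcomp Require Import all_classical all_reals all_analysis.

Set Implicit Arguments.
Unset Strict Implicit.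
Unset Printing Implicit Defensive.

Import Order.TTheory GRing.Theory Num.Theory numFieldNormedType.Exports.
Local Open Scope classical_set_scope.
Local Open Scope ring_scope.

(** * Linear algebra and representations *)

Section LinearAlgebra.
Variable F : fieldType.

Lemma char_poly_conj r (C C' T : 'M[F]_r) :
  T \in unitmx -> C *m T = T *m C' -> char_poly C = char_poly C'.
Proof.
move=> Tu CT; pose T' := map_mx (@polyC F) T.
have E : char_poly_mx C *m T' = T' *m char_poly_mx C'.
  by rewrite /char_poly_mx mulmxBl mulmxBr scalar_mxC -!map_mxM CT.
have T'0 : \det T' != 0.
  by rewrite det_map_mx polyC_eq0 -unitfE -unitmxE.
by apply: (mulIf T'0); rewrite /char_poly -det_mulmx E det_mulmx mulrC.
Qed.

Lemma char_poly_block_diag r s (C : 'M[F]_r) (D : 'M[F]_s) :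
  char_poly (block_mx C 0 0 D) = char_poly C * char_poly D.
Proof. by rewrite /char_poly char_block_diag_mx det_ublock. Qed.

(** Frees the characteristic polynomial of a restriction from the particular basis [row_base A]: the
    matrix [T] that expresses [B] in that basis is invertible and conjugates the two
    restrictions. *)
Lemma char_poly_restrict n r (A f : 'M[F]_n) (B : 'M[F]_(r, n)) (C : 'M[F]_r) :
  row_free B -> (B :=: A)%MS -> B *m f = C *m B ->
  char_poly (conjmx (row_base A) f) = char_poly C.
Proof.
move=> Bf BA Bs; have rA : r = \rank A by rewrite -BA (eqP Bf).
subst r; set B' := row_base A.
have BB' : (B <= B')%MS by rewrite eq_row_base BA.
have B'B : (B' <= B)%MS by rewrite eq_row_base BA.
have B'f : (B' *m f <= B')%MS.
  rewrite -[X in (X *m f <= _)%MS](mulmxKpV B'B) -mulmxA Bs mulmxA.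
  exact: submx_trans (submxMl _ _) BB'.
have BT := mulmxKpV BB'; set T := B *m _ in BT.
have Tu : T \in unitmx.
  rewrite -row_free_unit /row_free -(mxrankMfree _ (row_base_free A)) BT.
  exact: Bf.
apply/esym/(char_poly_conj Tu)/(row_free_inj (row_base_free A)).
rewrite -[RHS]mulmxA [RHS](_ : _ = T *m (B' *m f)); last first.
  by congr (_ *m _); rewrite mulmxKpV.
by rewrite -mulmxA BT mulmxA BT.
Qed.

(** Guarantees that the choice made in [L_invariants] succeeds. If no matrix had row space [P],
    vectors of [P] could be adjoined one at a time forever, until the rank exceeds [n]. *)
Lemma subspace_mx n (P : 'rV[F]_n -> Prop) :
  P 0 -> (forall a u v, P u -> P v -> P (a *: u + v)) ->
  exists A : 'M[F]_n, forall v, (v <= A)%MS <-> P v.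
Proof.
move=> P0 PD; apply: contrapT => noA.
have sub r : exists2 A : 'M[F]_n,
    (r <= \rank A)%N & forall v, (v <= A)%MS -> P v.
  elim: r => [|r [A rA AP]].
    by exists 0 => // v; rewrite submx0 => /eqP->.
  have [v Pv vA] : exists2 v, P v & ~~ (v <= A)%MS.
    apply: contrapT => H; apply: noA; exists A => v; split=> [/AP//|Pv].
    by apply: contrapT => /negP vA; apply: H; exists v.
  exists (A + v)%MS.
    apply: leq_ltn_trans rA _; rewrite ltn_neqAle mxrankS ?addsmxSl// andbT.
    apply: contraNneq vA => rE; apply: submx_trans (addsmxSr A v) _.
    by rewrite -(geq_leqif (mxrank_leqif_sup (addsmxSl A v))) rE.
  move=> u /sub_addsmxP [[x y] ->] /=; rewrite addrC.
  rewrite [y]mx11_scalar mul_scalar_mx; apply: PD => //.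
  by apply: AP; rewrite submxMl.
have [A nA _] := sub n.+1.
by have := leq_trans nA (rank_leq_row A); rewrite ltnn.
Qed.

(** With [p] the characteristic polynomial of [C], that of [z *: C] is [z ^+ n] times [p] evaluated
    at [X / z], and this substitution moves the root [x / z] to [x] without changing its
    multiplicity. *)
Lemma mup_char_polyZ n (C : 'M[F]_n) (z x : F) : z != 0 ->
  mup x (char_poly (z *: C)) = mup (x / z) (char_poly C).
Proof.
move=> z0; set p := char_poly C.
have E : char_poly (z *: C) = z ^+ n *: (p \Po (z^-1 *: 'X)).
  rewrite /p /char_poly -mul_polyC rmorphXn -det_map_mx -detZ.
  congr (\det _); apply/matrixP => i j; rewrite !mxE.
  rewrite /= rmorphB /= comp_polyC rmorphMn /= comp_polyX mulrBr -rmorphM.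
  by rewrite mulrnAr mul_polyC scalerA divff// scale1r.
have [m [r]] := multiplicity_XsubC p (x / z).
rewrite monic_neq0 ?char_poly_monic//= => rx pE.
have mx y s : ~~ root s y -> mup y (s * ('X - y%:P) ^+ m) = m.
  by move=> sy; rewrite mupMr// mup_XsubCX eqxx.
rewrite E pE mx// comp_polyM rmorphXn /= comp_polyB comp_polyX comp_polyC.
have -> : z^-1 *: 'X - (x / z)%:P = (z^-1)%:P * ('X - x%:P).
  by rewrite mulrBr mul_polyC -rmorphM mulrC.
rewrite exprMn mulrCA -mul_polyC mulrA mulrA mx//.
rewrite /root !hornerE horner_comp !hornerE mulrC !mulf_neq0 ?expf_neq0 ?invr_eq0//.
Qed.

End LinearAlgebra.

(** * Isomorphisms of representations with direct sums, tensor products and duals *)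

Section RepIso.
Variables (F : fieldType) (G : groupType).
Implicit Types V W : rep F G.

Lemma rep_iso_sym V W : rep_iso V W -> rep_iso W V.
Proof.
move=> [P [Q [PQ QP PV]]]; exists Q, P; split=> // g.
by rewrite -[RHS]mulmx1 -PQ !mulmxA -(mulmxA Q) PV mulmxA QP mul1mx.
Qed.

(** The biproduct criterion. Only the projections have to be equivariant, since together they form
    the isomorphism. *)
Lemma rep_iso_dsumP V W1 W2
    (i1 : 'M[F]_(rep_dim W1, rep_dim V)) (i2 : 'M[F]_(rep_dim W2, rep_dim V))
    (p1 : 'M[F]_(rep_dim V, rep_dim W1)) (p2 : 'M[F]_(rep_dim V, rep_dim W2)) :
  i1 *m p1 = 1%:M -> i1 *m p2 = 0 -> i2 *m p1 = 0 -> i2 *m p2 = 1%:M ->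
  p1 *m i1 + p2 *m i2 = 1%:M ->
  (forall g, V g *m p1 = p1 *m W1 g) -> (forall g, V g *m p2 = p2 *m W2 g) ->
  rep_iso V (rep_dsum W1 W2).
Proof.
move=> e11 e12 e21 e22 e1 h1 h2; exists (row_mx p1 p2), (col_mx i1 i2).
split=> [||g] /=; first by rewrite mul_row_col.
  by rewrite mul_col_row e11 e12 e21 e22 -scalar_mx_block.
by rewrite mul_mx_row mul_row_block !mulmx0 addr0 add0r h1 h2.
Qed.

(** The cast serves dimensions that are equal but not convertible, such as [n * 1] and [n]; for
    convertible ones [e] is [erefl]. *)
Lemma rep_iso_cast V W (e : rep_dim V = rep_dim W) :
  (forall g, W g = castmx (e, e) (V g)) -> rep_iso V W.
Proof.
case: W e => n W W1 WM /= e; case: n / e W W1 WM => W W1 WM WV.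
exists 1%:M, 1%:M; split=> [||g] /=; rewrite ?mulmx1 ?mul1mx//.
Qed.

Lemma tensmx11 m n : 1%:M *t 1%:M = 1%:M :> 'M[F]_(m * n).
Proof.
apply/matrixP => i j; case: (mxtens_indexP i) => i0 i1.
case: (mxtens_indexP j) => j0 j1.
rewrite tensmxE !mxE (inj_eq (can_inj (@mxtens_indexK _ _))) xpair_eqE.
by case: (i0 == j0); case: (i1 == j1); rewrite ?mulr1 ?mulr0 ?mul0r.
Qed.

Lemma rep_iso_tensl V V' W : rep_iso V V'
  -> rep_iso (rep_tens V W) (rep_tens V' W).
Proof.
move=> [P [Q [PQ QP PV]]]; exists (P *t 1%:M), (Q *t 1%:M).
by split=> [||g] /=; rewrite !tensmx_mul ?PQ ?QP ?PV ?mulmx1 ?mul1mx ?tensmx11.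
Qed.

Lemma rep_iso_tensr V W W' : rep_iso W W'
  -> rep_iso (rep_tens V W) (rep_tens V W').
Proof.
move=> [P [Q [PQ QP PV]]]; exists (1%:M *t P), (1%:M *t Q).
by split=> [||g] /=; rewrite !tensmx_mul ?PQ ?QP ?PV ?mulmx1 ?mul1mx ?tensmx11.
Qed.

Lemma rep_iso_dual V W : rep_iso V W -> rep_iso (rep_dual V) (rep_dual W).
Proof.
move=> /rep_iso_sym [P [Q [PQ QP PV]]]; exists P^T, Q^T.
by split=> [||g] /=; rewrite -!trmx_mul ?PQ ?QP ?trmx1// PV.
Qed.

Lemma tensmxDl m n p q (A B : 'M[F]_(m, n)) (C : 'M[F]_(p, q)) :
  (A + B) *t C = A *t C + B *t C.
Proof. by apply/matrixP => i j; rewrite !mxE mulrDl. Qed.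

Lemma tensmxDr m n p q (A B : 'M[F]_(m, n)) (C : 'M[F]_(p, q)) :
  C *t (A + B) = C *t A + C *t B.
Proof. by apply/matrixP => i j; rewrite !mxE mulrDr. Qed.

Lemma dsum_proj m n :
  col_mx 1%:M 0 *m row_mx 1%:M 0 + col_mx 0 1%:M *m row_mx 0 1%:M
  = 1%:M :> 'M[F]_(m + n).
Proof.
by rewrite !mul_col_row !mulmx1 !mulmx0 add_block_mx !addr0 !add0r -scalar_mx_block.
Qed.

Lemma block_mx_col1 m n (A : 'M[F]_m) (D : 'M[F]_n) :
  block_mx A 0 0 D *m col_mx 1%:M 0 = col_mx 1%:M 0 *m A.
Proof.
by rewrite mul_block_col mul_col_mx !mulmx0 !mulmx1 mul0mx mul1mx !addr0.
Qed.

Lemma block_mx_col2 m n (A : 'M[F]_m) (D : 'M[F]_n) :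
  block_mx A 0 0 D *m col_mx 0 1%:M = col_mx 0 1%:M *m D.
Proof.
by rewrite mul_block_col mul_col_mx !mulmx0 !mulmx1 mul0mx mul1mx !add0r.
Qed.

Lemma rep_tens_dsuml V V' W :
  rep_iso (rep_tens (rep_dsum V V') W)
          (rep_dsum (rep_tens V W) (rep_tens V' W)).
Proof.
apply: (@rep_iso_dsumP (rep_tens (rep_dsum V V') W)
          (rep_tens V W) (rep_tens V' W)
          (row_mx 1%:M 0 *t 1%:M) (row_mx 0 1%:M *t 1%:M)
          (col_mx 1%:M 0 *t 1%:M) (col_mx 0 1%:M *t 1%:M)) => [||||| g | g];
  rewrite !tensmx_mul /= ?mul_row_col ?mulmx0 ?mul0mx ?mulmx1 ?addr0 ?add0r
    ?tensmx11 ?tens0mx ?mul1mx// -?tensmxDl ?dsum_proj ?tensmx11//.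
  by rewrite block_mx_col1.
by rewrite block_mx_col2.
Qed.

Lemma rep_tens_dsumr V W W' :
  rep_iso (rep_tens V (rep_dsum W W'))
          (rep_dsum (rep_tens V W) (rep_tens V W')).
Proof.
apply: (@rep_iso_dsumP (rep_tens V (rep_dsum W W'))
          (rep_tens V W) (rep_tens V W')
          (1%:M *t row_mx 1%:M 0) (1%:M *t row_mx 0 1%:M)
          (1%:M *t col_mx 1%:M 0) (1%:M *t col_mx 0 1%:M)) => [||||| g | g];
  rewrite !tensmx_mul /= ?mul_row_col ?mulmx0 ?mul0mx ?mulmx1 ?addr0 ?add0r
    ?tensmx11 ?tensmx0 ?mul1mx// -?tensmxDr ?dsum_proj ?tensmx11//.
  by rewrite block_mx_col1.
by rewrite block_mx_col2.
Qed.

Lemma rep_dual_dsum V W :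
  rep_iso (rep_dual (rep_dsum V W)) (rep_dsum (rep_dual V) (rep_dual W)).
Proof.
apply: (@rep_iso_cast (rep_dual (rep_dsum V W))
  (rep_dsum (rep_dual V) (rep_dual W)) (erefl _)) => g.
by rewrite castmx_id /= tr_block_mx !trmx0.
Qed.

Lemma rep_tensC V W : rep_iso (rep_tens V W) (rep_tens W V).
Proof.
(* The permutation matrix that exchanges the two tensor factors on basis vectors. *)
pose swap m n : 'M[F]_(m * n, n * m) := \matrix_(i, j)

  (((mxtens_unindex i).1 == (mxtens_unindex j).2)%:R *
   ((mxtens_unindex i).2 == (mxtens_unindex j).1)%:R).
have swapE m n i0 i1 j0 j1 :
    swap m n (mxtens_index (i0, i1)) (mxtens_index (j0, j1)) =
    (i0 == j1)%:R * (i1 == j0)%:R.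
  by rewrite mxE !mxtens_indexK.
have swapK m n : swap m n *m swap n m = 1%:M.
  apply/matrixP => i j; case: (mxtens_indexP i) => i0 i1.
  case: (mxtens_indexP j) => j0 j1; rewrite mxE.
  rewrite (bigD1 (mxtens_index (i1, i0)))//= big1 => [|k].
    rewrite !swapE !eqxx !mul1r addr0 mxE.
    rewrite (inj_eq (can_inj (@mxtens_indexK _ _))) xpair_eqE andbC.
    by case: (_ == _); case: (_ == _); rewrite ?mulr1 ?mulr0.
  case: (mxtens_indexP k) => k0 k1.
  rewrite (inj_eq (can_inj (@mxtens_indexK _ _))) xpair_eqE swapE.
  by rewrite eq_sym (eq_sym k1); case: (i1 == k0) => //=; case: (i0 == k1);
    rewrite ?mulr0 ?mul0r.
exists (swap _ _), (swap _ _); split=> [||g] /=; [exact: swapK|exact: swapK|].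
apply/matrixP => i j; case: (mxtens_indexP i) => i0 i1.
case: (mxtens_indexP j) => j0 j1; rewrite !mxE.
rewrite (bigD1 (mxtens_index (j1, j0)))//= [X in _ + X]big1 => [|k].
  rewrite (bigD1 (mxtens_index (i1, i0)))//= [X in _ = _ + X]big1 => [|k].
    by rewrite !tensmxE !swapE !eqxx !mulr1 !mul1r !addr0 mulrC.
  case: (mxtens_indexP k) => k0 k1.
  rewrite (inj_eq (can_inj (@mxtens_indexK _ _))) xpair_eqE swapE.
  by rewrite eq_sym (eq_sym k1); case: (i1 == k0) => //=; case: (i0 == k1);
    rewrite ?mulr0 ?mul0r.
case: (mxtens_indexP k) => k0 k1.
rewrite (inj_eq (can_inj (@mxtens_indexK _ _))) xpair_eqE swapE.
by case: (k0 == j1) => //=; case: (k1 == j0); rewrite ?mulr0 ?mul0r ?mulr0.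
Qed.
End RepIso.

(** * Additive functions of representations *)

Section Scaling.
Variables (F : fieldType) (G : groupType).
Implicit Types V W : rep F G.

Record mchar := MChar {
  mchar_fun :> G -> F;
  mchar1 : mchar_fun 1%g = 1;
  mcharM : forall g h, mchar_fun (g * h)%g = mchar_fun g * mchar_fun h
}.

Lemma mchar_neq0 (chi : mchar) g : chi g != 0.
Proof.
apply/negP => /eqP c0; have := mchar1 chi.
by rewrite -(mulgV g) mcharM c0 mul0r => /esym/eqP; rewrite oner_eq0.
Qed.

Lemma mcharV (chi : mchar) g : chi g^-1%g = (chi g)^-1.
Proof.
by apply: (mulIf (mchar_neq0 chi g));
  rewrite -mcharM mulVg mchar1 mulVf ?mchar_neq0.
Qed.

(** The twist of [V] by [chi], kept on the space of [V] so that the dimension does not become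
    [rep_dim V * 1]. *)
Program Definition rep_scale (chi : mchar) V : rep F G :=
  @Rep F G (rep_dim V) (fun g => chi g *: V g) _ _.
Next Obligation. by move=> chi V /=; rewrite mchar1 scale1r rep_mx1. Qed.
Next Obligation.
move=> chi V g h /=.
by rewrite mcharM rep_mxM -scalemxAl -scalemxAr scalerA.
Qed.

Program Definition mchar_inv (chi : mchar) : mchar :=
  @MChar (fun g => (chi g)^-1) _ _.
Next Obligation. by move=> chi /=; rewrite mchar1 invr1. Qed.
Next Obligation. by move=> chi g h /=; rewrite mcharM invfM. Qed.

Lemma tensmxZl m n p q a (A : 'M[F]_(m, n)) (B : 'M[F]_(p, q)) :
  (a *: A) *t B = a *: (A *t B).
Proof. by apply/matrixP => i j; rewrite !mxE mulrA. Qed.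

Lemma tensmxZr m n p q a (A : 'M[F]_(m, n)) (B : 'M[F]_(p, q)) :
  A *t (a *: B) = a *: (A *t B).
Proof. by apply/matrixP => i j; rewrite !mxE mulrCA. Qed.

Lemma rep_tens_scalel chi V W :
  rep_iso (rep_tens (rep_scale chi V) W) (rep_scale chi (rep_tens V W)).
Proof.
apply: (@rep_iso_cast _ _ (rep_tens (rep_scale chi V) W)
  (rep_scale chi (rep_tens V W)) (erefl _)) => g.
by rewrite castmx_id /= tensmxZl.
Qed.

Lemma rep_tens_dual_scale chi V W :
  rep_iso (rep_tens V (rep_dual (rep_scale chi W)))
          (rep_scale (mchar_inv chi) (rep_tens V (rep_dual W))).
Proof.
apply: (@rep_iso_cast _ _ (rep_tens V (rep_dual (rep_scale chi W)))
  (rep_scale (mchar_inv chi) (rep_tens V (rep_dual W))) (erefl _)) => g.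
by rewrite castmx_id /= linearZ /= mcharV tensmxZr.
Qed.

(** A direct sum of characters. Indexing them by [nat] makes the tail a mere shift of [chi], as the
    inductions on [n] require. *)
Program Definition rep_diag n (chi : nat -> mchar) : rep F G :=
  @Rep F G n (fun g => diag_mx (\row_(a < n) chi a g)) _ _.
Next Obligation.
move=> n chi /=; apply/matrixP => i j; rewrite !mxE mchar1.
by [].
Qed.
Next Obligation.
move=> n chi g h /=; rewrite mulmx_diag; congr diag_mx; apply/rowP => j.
by rewrite !mxE mcharM.
Qed.

Lemma rep_diagS n chi :
  rep_iso (rep_diag n.+1 chi)
          (rep_dsum (rep_diag 1 chi) (rep_diag n (fun a => chi a.+1))).
Proof.
apply: (@rep_iso_cast _ _ (rep_diag n.+1 chi)
  (rep_dsum (rep_diag 1 chi) (rep_diag n (fun a => chi a.+1))) (erefl _)) => g.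
rewrite castmx_id /=; apply/matrixP => i j; rewrite !mxE.
case: split_ordP => a ->; rewrite !mxE; case: split_ordP => b ->;
  rewrite !mxE ?eq_shift ?mulr0n//.
  by rewrite (eq_lrshift a b) mulr0n.
by rewrite (eq_rlshift a b) mulr0n.
Qed.

Lemma rep_tens_diag1 V chi :
  rep_iso (rep_tens V (rep_diag 1 chi)) (rep_scale (chi 0%N) V).
Proof.
apply: (@rep_iso_cast _ _ (rep_tens V (rep_diag 1 chi))
  (rep_scale (chi 0%N) V) (muln1 _)) => g /=.
have -> : diag_mx (\row_(a < 1) chi a g) = (chi 0%N g)%:M.
  by apply/matrixP => i j; rewrite !mxE !ord1.
by rewrite tens_mx_scalar castmx_comp castmx_id.
Qed.

End Scaling.

Section Additive.
Variables (F : fieldType) (G : groupType).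
Implicit Types V W : rep F G.

(** Such an [f] depends only on the class in the Grothendieck group for direct sums. Decompositions
    of parameters are recorded as identities for all additive [f], so that they can be applied in
    each factor of a tensor product in turn. *)
Definition rep_additive (f : rep F G -> nat) : Prop :=
  (forall V W, rep_iso V W -> f V = f W) /\
  (forall V W, f (rep_dsum V W) = (f V + f W)%N).

Lemma rep_additive_dim0 f V : rep_additive f -> rep_dim V = 0%N -> f V = 0%N.
Proof.
move=> [fI fD] V0.
(* In dimension 0, [V] is isomorphic to its double, whence [f V + f V = f V]. *)
have e : rep_dim (rep_dsum V V) = rep_dim V by rewrite /= V0.
have : f (rep_dsum V V) = f V.
  apply/fI/(rep_iso_cast (e := e)) => g; apply/matrixP => i.
  by have := leq_trans (ltn_ord i) (eq_leq V0).
by rewrite fD; lia.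
Qed.

Lemma rep_additive_bigsum f d (V : nat -> rep F G) : rep_additive f ->
  f (rep_bigsum d V) = (\sum_(i < d) f (V i))%N.
Proof.
move=> fA; case: (fA) => fI fD; elim: d V => [|d IHd] V.
  by rewrite big_ord0; apply: rep_additive_dim0; rewrite //= big_ord0.
rewrite big_ord_recl -(IHd (fun i => V i.+1)) -fD; apply: fI.
have e : rep_dim (rep_bigsum d.+1 V) =
    rep_dim (rep_dsum (V 0%N) (rep_bigsum d (fun i => V i.+1))).
  by rewrite /= big_ord_recl.
apply: (rep_iso_cast (e := e)) => g /=; rewrite mxdiag_recl castmx_comp.
by rewrite castmx_id.
Qed.

Lemma rep_additive_tens_diag f V n chi : rep_additive f ->
  f (rep_tens V (rep_diag n chi)) = (\sum_(a < n) f (rep_scale (chi a) V))%N.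
Proof.
move=> fA; case: (fA) => fI fD; elim: n chi => [|n IHn] chi.
  by rewrite big_ord0; apply: rep_additive_dim0; rewrite //= muln0.
rewrite big_ord_recl (fI _ _ (rep_iso_tensr V (rep_diagS n chi))).
rewrite (fI _ _ (rep_tens_dsumr _ _ _)) fD IHn; congr addn.
exact/fI/rep_tens_diag1.
Qed.

Lemma rep_additive_tensl f W : rep_additive f ->
  rep_additive (fun V => f (rep_tens V W)).
Proof.
move=> [fI fD]; split=> [V V' VV'|V V']; first exact/fI/rep_iso_tensl.
by rewrite (fI _ _ (rep_tens_dsuml _ _ _)) fD.
Qed.

Lemma rep_additive_tens_dual f V : rep_additive f ->
  rep_additive (fun W => f (rep_tens V (rep_dual W))).
Proof.
move=> [fI fD]; split=> [W W' WW'|W W'].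
  exact/fI/rep_iso_tensr/rep_iso_dual.
rewrite (fI _ _ (rep_iso_tensr V (rep_dual_dsum W W'))).
by rewrite (fI _ _ (rep_tens_dsumr _ _ _)) fD.
Qed.

End Additive.

(** * Multiplicities of Frobenius eigenvalues *)

Section FrobeniusMultiplicity.
Variables (R : realType) (k : nonarch_local_field) (K : separable_closure k).
Variable Phi : weil K.
Local Notation C := R[i].
Local Notation WD := (WD R K).
Implicit Types V W : rep C WD.

Local Notation frob V := (V (Phi, weil_torus R Phi))^T.

(** The algebraic multiplicity of the eigenvalue [x]. The matrix is the one inside [L_function],
    namely [restrictmx] unfolded. *)
Definition frob_mult (x : C) V : nat :=
  mup x (char_poly (conjmx (row_base (L_invariants V)) (frob V))).

Lemma L_invariantsP V (v : 'rV[C]_(rep_dim V)) :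
  (v <= L_invariants V)%MS <-> L_invariant v.
Proof.
have [|a u w uI wI|A AP] := @subspace_mx _ _ (@L_invariant R k K V).
- by move=> w x _; rewrite mul0mx.
- by move=> g x g0; rewrite mulmxDl -scalemxAl uI// wI.
have := @xgetPex _ (0 : 'M[C]_(rep_dim V))
  [set A : 'M[C]_(rep_dim V) | forall v, (v <= A)%MS <-> @L_invariant R k K V v].
by move=> /(_ (ex_intro _ A AP)) /(_ v).
Qed.

(** The torus normalizes the upper unipotent subgroup; this is what lets Frobenius, with its torus
    component, preserve the invariants. *)
Lemma torus_unip (t : C) (t0 : t != 0) x :
  (unip x * torus t0 = torus t0 * unip (t^-1 ^+ 2 * x) :> sl2 C)%g.
Proof.
apply: val_inj; apply/matrixP => i j.
rewrite !mxE !big_ord_recl !big_ord0 !mxE /=.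
case: i => [[|[|//]] ?]; case: j => [[|[|//]] ?] /=;
  rewrite ?mulr0 ?mul0r ?mulr1 ?mul1r ?addr0 ?add0r//.
by rewrite expr2 !mulrA divff// mul1r mulrC.
Qed.

Lemma L_invariant_frob V v : L_invariant v -> @L_invariant R k K V (v *m frob V).
Proof.
move=> vI w x w0; rewrite -mulmxA -trmx_mul -rep_mxM.
(* Inertia, the kernel of the degree, is normal. *)
pose w' : weil K := (Phi^-1 * w * Phi)%g.
have w'0 : weil_deg w' = 0 by rewrite /w' /= w0; lia.
pose t0 := @weil_sqrtnorm_neq0 R k K Phi.
have -> : ((w, unip x) * (Phi, weil_torus R Phi) =
  (Phi, weil_torus R Phi) * (w', unip ((weil_sqrtnorm R Phi)^-1 ^+ 2 * x)) :> WD)%g.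
  congr pair; last exact: torus_unip.
  by rewrite /= /w' !mulgA mulgV mul1g.
by rewrite rep_mxM trmx_mul mulmxA vI.
Qed.

Lemma frob_multE x V r (B : 'M[C]_(r, rep_dim V)) (D : 'M[C]_r) :
  row_free B -> (forall v, (v <= B)%MS <-> L_invariant v) ->
  B *m frob V = D *m B -> frob_mult x V = mup x (char_poly D).
Proof.
move=> Bf BP BD; rewrite /frob_mult (char_poly_restrict Bf _ BD)//.
apply/eqmxP/andP; split; apply/rV_subP => v vI.
  by apply/L_invariantsP/BP.
by apply/BP/L_invariantsP.
Qed.

Lemma frob_mult_basis V : exists r (B : 'M[C]_(r, rep_dim V)) (D : 'M[C]_r),
  [/\ row_free B, forall v, (v <= B)%MS <-> L_invariant v &
      B *m frob V = D *m B].
Proof.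
exists _, (row_base (L_invariants V)).
exists (conjmx (row_base (L_invariants V)) (frob V)); split.
- exact: row_base_free.
- by move=> v; rewrite eq_row_base L_invariantsP.
- rewrite mulmxKpV//; apply/rV_subP => v /submxP [c ->].
  rewrite eq_row_base mulmxA; apply/L_invariantsP/L_invariant_frob/L_invariantsP.
  by rewrite -(eq_row_base (L_invariants V)) submxMl.
Qed.

(** The isomorphism carries a basis of the invariants of [V] to one for [W], on which Frobenius has
    the same matrix [D]. *)
Lemma frob_mult_iso x V W : rep_iso V W -> frob_mult x V = frob_mult x W.
Proof.
move=> VW; have [Q [P [QP PQ WQ]]] := rep_iso_sym VW.
have [r [B [D [Bf BP BD]]]] := frob_mult_basis V.
have [PQ' QP'] : P^T *m Q^T = 1%:M /\ Q^T *m P^T = 1%:M.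
  by rewrite -!trmx_mul QP PQ !trmx1.
have VQ g : (V g)^T *m Q^T = Q^T *m (W g)^T by rewrite -!trmx_mul WQ.
rewrite (frob_multE x Bf BP BD) (@frob_multE x W r (B *m Q^T) D)//.
- apply/row_freeP; have [B' BB'] := row_freeP Bf.
  by exists (P^T *m B'); rewrite mulmxA -(mulmxA B) QP' mulmx1.
- move=> v; rewrite -[v in (v <= _)%MS]mulmx1 -PQ' mulmxA.
  have -> : (v *m P^T *m Q^T <= B *m Q^T)%MS = (v *m P^T <= B)%MS.
    apply/idP/idP => [/(submxMr P^T)|/submxMr]; last exact.
    by rewrite -!mulmxA QP' !mulmx1.
  rewrite BP; split=> vI w y w0.
    by rewrite -[v]mulmx1 -PQ' mulmxA -[LHS]mulmxA -VQ mulmxA vI.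
  rewrite -[LHS]mulmx1 -QP' mulmxA -(mulmxA _ _ Q^T) VQ.
  by rewrite !mulmxA -(mulmxA v) PQ' mulmx1 vI.
- by rewrite -mulmxA -VQ !mulmxA BD.
Qed.

Lemma sub_block_diag m n p q (v1 : 'rV[C]_m) (v2 : 'rV[C]_n)
    (B1 : 'M[C]_(p, m)) (B2 : 'M[C]_(q, n)) :
  (row_mx v1 v2 <= block_mx B1 0 0 B2)%MS = (v1 <= B1)%MS && (v2 <= B2)%MS.
Proof.
apply/idP/andP => [/submxP [c]|[/submxP [c ->] /submxP [d ->]]].
  rewrite -[c]hsubmxK mul_row_block !mulmx0 addr0 add0r => /eq_row_mx [-> ->].
  by rewrite !submxMl.
apply/submxP; exists (row_mx c d).
by rewrite mul_row_block !mulmx0 addr0 add0r.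
Qed.

Lemma frob_mult_dsum x V W :
  frob_mult x (rep_dsum V W) = (frob_mult x V + frob_mult x W)%N.
Proof.
have [r [B [D [Bf BP BD]]]] := frob_mult_basis V.
have [s [B' [D' [Bf' BP' BD']]]] := frob_mult_basis W.
rewrite (frob_multE x Bf BP BD) (frob_multE x Bf' BP' BD').
rewrite -mupM ?monic_neq0 ?char_poly_monic// -char_poly_block_diag.
apply: (@frob_multE x (rep_dsum V W) _ (block_mx B 0 0 B')) => [|v|].
- have [[b Bb] [b' Bb']] := (row_freeP Bf, row_freeP Bf').
  apply/row_freeP; exists (block_mx b 0 0 b').
  by rewrite mulmx_block !mulmx0 !mul0mx !addr0 add0r Bb Bb' -scalar_mx_block.
- rewrite -[v]hsubmxK; move: (lsubmx v) (rsubmx v) => v1 v2.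
  have vI w y : row_mx v1 v2 *m (rep_dsum V W (w, unip y))^T =
      row_mx (v1 *m (V (w, unip y))^T) (v2 *m (W (w, unip y))^T).
    by rewrite /= tr_block_mx mul_row_block !trmx0 !mulmx0 addr0 add0r.
  rewrite sub_block_diag; split=> [/andP[/BP v1I /BP' v2I] w y w0|vI'].
    by rewrite vI v1I// v2I.
  by apply/andP; split; [apply/BP|apply/BP'] => w y w0;
    have := vI' w y w0; rewrite vI => /eq_row_mx[].
- rewrite /= tr_block_mx !trmx0 !mulmx_block.
  by rewrite !mulmx0 !mul0mx !addr0 !add0r BD BD'.
Qed.

Lemma frob_mult_additive x : rep_additive (frob_mult x).
Proof. by split; [exact: frob_mult_iso | exact: frob_mult_dsum]. Qed.

(** A character trivial on inertia and on the unipotents leaves the space of invariants unchanged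
    and multiplies Frobenius by a scalar. *)
Lemma frob_mult_scale x (chi : mchar C WD) V :
  (forall w y, weil_deg w = 0 -> chi (w, unip y) = 1) ->
  frob_mult x (rep_scale chi V) = frob_mult (x / chi (Phi, weil_torus R Phi)) V.
Proof.
move=> chi1; have [r [B [D [Bf BP BD]]]] := frob_mult_basis V.
rewrite (frob_multE _ Bf BP BD) -mup_char_polyZ ?mchar_neq0//.
apply: (@frob_multE x (rep_scale chi V) _ B) => // [v|].
  by rewrite BP; split=> vI w y w0; have := vI w y w0; rewrite /= chi1// scale1r.
by rewrite /= linearZ /= -scalemxAr BD scalemxAl.
Qed.

Lemma frob_mult_gt0 x V : (0 < frob_mult x V)%N ->
  exists v : 'rV[C]_(rep_dim V),
    [/\ v != 0, L_invariant v & v *m frob V = x *: v].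
Proof.
have [r [B [D [Bf BP BD]]]] := frob_mult_basis V.
rewrite (frob_multE _ Bf BP BD) => mu0.
have : eigenvalue D x.
  rewrite eigenvalue_root_char; apply: contraTT mu0 => /mupNroot->.
  by rewrite ltnn.
move=> /eigenvalueP [u uD u0]; exists (u *m B); split.
- by rewrite mulmx_free_eq0.
- by apply/BP; rewrite submxMl.
- by rewrite -mulmxA BD mulmxA uD scalemxAl.
Qed.

End FrobeniusMultiplicity.

(** * Bounds on Frobenius eigenvalues *)

Section Tame.
Variable C : numFieldType.

(** Interpolation from the nodes [a, ..., a + n - 1], with a constant that depends on [n] and [a]
    only. The induction removes the node [a] by dividing [p - p(a)] by [X - a]. *)
Lemma poly0_bound (n a : nat) : (0 < a)%N ->
  exists2 M : C, 0 <= M & forall (p : {poly C}) (B : C), (size p <= n)%N ->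
    0 <= B -> (forall j, (a <= j < a + n)%N -> `|p.[j%:R]| <= B) ->
    `|p.[0]| <= M * B.
Proof.
elim: n a => [|n IHn] a a0.
  exists 0 => // p B; rewrite leqn0 size_poly_eq0 => /eqP-> B0 _.
  by rewrite horner0 normr0 mul0r.
(* From [p(0) = p(a) - a q(0)]: the quotient [q] is at most [2 * B] at the remaining nodes, as these
   are at distance at least 1 from [a]. *)
have [M M0 HM] := IHn a.+1 isT; exists (1 + a%:R * (M * 2)).
  by rewrite addr_ge0 ?mulr_ge0 ?ler0n.
move=> p B sp B0 pB.
have [q qE] : exists q : {poly C}, p - (p.[a%:R])%:P = q * ('X - (a%:R)%:P).
  by apply/factor_theorem; rewrite /root !hornerE subrr.
have sq : (size q <= n)%N.
  have [->|q0] := eqVneq q 0; first by rewrite size_poly0.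
  have : (size (q * ('X - (a%:R)%:P))%R <= n.+1)%N.
    rewrite -qE (leq_trans (size_polyD _ _))// geq_max sp size_polyN.
    by rewrite (leq_trans (size_polyC_leq1 _)).
  by rewrite size_Mmonic ?monicXsubC// size_XsubC addn2.
have pE x : p.[x] = p.[a%:R] + q.[x] * (x - a%:R).
  by have /(congr1 (horner^~ x)) := qE; rewrite !hornerE => <-; rewrite subrKC.
have pa : `|p.[a%:R]| <= B by apply: pB; rewrite leqnn -addSnnS leq_addr.
have q0 : `|q.[0]| <= M * (B + B).
  apply: HM => // [|j /andP[aj ja]]; first by rewrite addr_ge0.
  have jE : q.[j%:R] * (j - a)%:R = p.[j%:R] - p.[a%:R].
    by rewrite pE natrB 1?ltnW// [RHS]addrC addKr.
  have ja1 : 1 <= (j - a)%:R :> C by rewrite ler1n subn_gt0.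
  apply: (@le_trans _ _ (`|q.[j%:R]| * (j - a)%:R)).
    by rewrite ler_peMr.
  rewrite -[X in _ * X]normr_nat -normrM jE.
  rewrite (le_trans (ler_normB _ _))// lerD// pB// ltnW//=.
  by rewrite -addSnnS.
rewrite pE sub0r (le_trans (ler_normD _ _))// mulrDl mul1r lerD//.
rewrite normrM normrN normr_nat mulrC -!mulrA ler_wpM2l ?ler0n//.
by rewrite (le_trans q0)// mulr2n mulrDl mul1r.
Qed.

Lemma low_det (t c : C) (t0 : t != 0) : \det (mx22 t 0 c t^-1) == 1.
Proof. by rewrite det_mx22 mul0r subr0 divff. Qed.

Definition low (t c : C) (t0 : t != 0) : sl2 C := SL2 (low_det c t0).

(* The consequences of algebraicity that are used. Unlike [algebraic_mx], they
   pass to [x |-> f x^-1] without any substitution in polynomials of several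
   variables. *)
Definition tame (f : sl2 C -> C) : Prop :=
  (exists d, forall t (t0 : t != 0), exists2 p : {poly C},
     (size p <= d)%N & forall c, f (low c t0) = p.[c]) /\
  (forall b : C, exists2 B : C, 0 <= B &
     forall g : sl2 C, (forall i j, `|g i j| <= b) -> `|f g| <= B).

Lemma tame_ext f g : f =1 g -> tame f -> tame g.
Proof. by move=> /funext->. Qed.

Lemma tame_const a : tame (fun=> a).
Proof.
split=> [|b]; last by exists `|a|.
by exists 1%N => t t0; exists a%:P => [|c]; rewrite ?size_polyC_leq1 ?hornerC.
Qed.

Lemma tame_entry i j : tame (fun g => g i j).
Proof.
split=> [|b]; last first.
  by exists `|b| => // g /(_ i j) gb; rewrite (ger0_norm (le_trans _ gb)).
exists 2%N => t t0; case: i => [[|[|//]] ?]; case: j => [[|[|//]] ?].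
- by exists t%:P => [|c]; rewrite ?(leq_trans (size_polyC_leq1 _)) ?hornerC// mxE.
- by exists 0 => [|c]; rewrite ?size_poly0 ?horner0// mxE.
- by exists 'X => [|c]; rewrite ?size_polyX ?hornerX// mxE.
- by exists (t^-1)%:P => [|c];
  rewrite ?(leq_trans (size_polyC_leq1 _)) ?hornerC// mxE.
Qed.

Lemma tameD f g : tame f -> tame g -> tame (fun x => f x + g x).
Proof.
move=> [[d fd] fb] [[e ge] gb]; split=> [|b].
  exists (maxn d e) => t t0; have [[p pd pE] [q qe qE]] := (fd t t0, ge t t0).
  exists (p + q) => [|c]; last by rewrite hornerD pE qE.
  by rewrite (leq_trans (size_polyD _ _))// geq_max !leq_max pd qe orbT.
have [[B B0 fB] [B' B'0 gB]] := (fb b, gb b).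
exists (B + B') => [|x xb]; first by rewrite addr_ge0.
by rewrite (le_trans (ler_normD _ _))// lerD ?fB ?gB.
Qed.

Lemma tameM f g : tame f -> tame g -> tame (fun x => f x * g x).
Proof.
move=> [[d fd] fb] [[e ge] gb]; split=> [|b].
  exists (d + e)%N => t t0; have [[p pd pE] [q qe qE]] := (fd t t0, ge t t0).
  exists (p * q) => [|c]; last by rewrite hornerM pE qE.
  by rewrite (leq_trans (size_polyMleq _ _))// (leq_trans (leq_pred _))// leq_add.
have [[B B0 fB] [B' B'0 gB]] := (fb b, gb b).
exists (B * B') => [|x xb]; first by rewrite mulr_ge0.
by rewrite normrM ler_pM ?fB ?gB.
Qed.

Lemma tame_sum (I : Type) (r : seq I) (f : I -> sl2 C -> C) :
  (forall i, tame (f i)) -> tame (fun x => \sum_(i <- r) f i x).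
Proof.
move=> fT; elim: r => [|i r IHr].
  by apply: (tame_ext _ (tame_const 0)) => x; rewrite big_nil.
by apply: (tame_ext _ (tameD (fT i) IHr)) => x; rewrite big_cons.
Qed.

Lemma tame_prod (I : Type) (r : seq I) (f : I -> sl2 C -> C) :
  (forall i, tame (f i)) -> tame (fun x => \prod_(i <- r) f i x).
Proof.
move=> fT; elim: r => [|i r IHr].
  by apply: (tame_ext _ (tame_const 1)) => x; rewrite big_nil.
by apply: (tame_ext _ (tameM (fT i) IHr)) => x; rewrite big_cons.
Qed.

Lemma tameX f n : tame f -> tame (fun x => f x ^+ n).
Proof.
move=> fT; elim: n => [|n IHn]; first exact: tame_const.
by apply: (tame_ext _ (tameM fT IHn)) => x; rewrite exprS.
Qed.

Lemma mx22M (a b c d a' b' c' d' : C) :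
  mx22 a b c d *m mx22 a' b' c' d' =
  mx22 (a * a' + b * c') (a * b' + b * d') (c * a' + d * c') (c * b' + d * d').
Proof.
apply/matrixP => i j; rewrite !mxE !big_ord_recl big_ord0 !mxE /= addr0.
by case: (i == 0); case: (j == 0).
Qed.

Lemma sl2_invE (g : sl2 C) :
  sl2_mx g^-1%g = mx22 (g 1 1) (- g 0 1) (- g 1 0) (g 0 0).
Proof.
have gE : sl2_mx g = mx22 (g 0 0) (g 0 1) (g 1 0) (g 1 1).
  apply/matrixP => i j; rewrite mxE.
  by case: i => [[|[|//]] ?]; case: j => [[|[|//]] ?]; congr (sl2_mx g _ _);
    apply: val_inj.
have gdet : g 0 0 * g 1 1 - g 0 1 * g 1 0 = 1.
  by rewrite -(sl2_det g) [in RHS]gE det_mx22.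
have : sl2_mx g *m mx22 (g 1 1) (- g 0 1) (- g 1 0) (g 0 0) = 1%:M.
  rewrite {1}gE mx22M !mulrN [g 0 0 * g 0 1]mulrC addNr [g 1 0 * g 1 1]mulrC subrr.
  rewrite gdet addrC [g 1 1 * _]mulrC [g 1 0 * _]mulrC gdet.
  apply/matrixP => i j; rewrite !mxE.
  by case: i => [[|[|//]] ?]; case: j => [[|[|//]] ?].
move=> gK; rewrite -[RHS]mul1mx -(mulVmx (sl2_unit g)) -mulmxA gK.
by rewrite mulmx1.
Qed.

(** Inversion sends the lower triangular matrix with parameters [t], [c] to the one with [t^-1],
    [- c], and the degree bound [d] is uniform in [t]. It permutes the entries up to sign, so bounds
    are kept. *)
Lemma tame_inv f : tame f -> tame (fun x => f x^-1%g).
Proof.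
move=> [[d fd] fb]; split=> [|b].
  exists d => t t0; have t'0 : t^-1 != 0 by rewrite invr_eq0.
  have [p pd pE] := fd _ t'0.
  exists (p \Po (- 'X)) => [|c].
    by rewrite size_comp_poly2// size_polyN size_polyX.
  rewrite horner_comp hornerN hornerX -pE; congr f; apply: val_inj.
  apply: (etrans (sl2_invE _)) => /=; apply/matrixP => i j; rewrite !mxE /=.
  by rewrite oppr0 invrK.
have [B B0 fB] := fb b; exists B => // g gb; apply: fB => i j.
rewrite (sl2_invE g) mxE; case: (i == 0); case: (j == 0);
  rewrite ?normrN; exact: gb.
Qed.

Section Bounded.
Variable T : Type.

Definition norm_bounded (f : T -> C) : Prop :=
  exists2 B : C, 0 <= B & forall x, `|f x| <= B.

Lemma norm_bounded_const a : norm_bounded (fun=> a).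
Proof. by exists `|a|. Qed.

Lemma norm_boundedD f g :
  norm_bounded f -> norm_bounded g -> norm_bounded (fun x => f x + g x).
Proof.
move=> [B B0 fB] [B' B'0 gB]; exists (B + B') => [|x]; first by rewrite addr_ge0.
by rewrite (le_trans (ler_normD _ _))// lerD ?fB ?gB.
Qed.

Lemma norm_boundedM f g :
  norm_bounded f -> norm_bounded g -> norm_bounded (fun x => f x * g x).
Proof.
move=> [B B0 fB] [B' B'0 gB]; exists (B * B') => [|x]; first by rewrite mulr_ge0.
by rewrite normrM ler_pM ?fB ?gB.
Qed.

Lemma norm_bounded_sum (I : Type) (r : seq I) (f : I -> T -> C) :
  (forall i, norm_bounded (f i)) -> norm_bounded (fun x => \sum_(i <- r) f i x).
Proof.
move=> fB; elim: r => [|i r IHr].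
  by under eq_fun do rewrite big_nil; exact: norm_bounded_const.
by under eq_fun do rewrite big_cons; exact: norm_boundedD.
Qed.

End Bounded.

End Tame.

(** * Bounded representations have no Frobenius eigenvalue greater than 1 on the invariants *)

Section Vanishing.
Variables (R : realType) (k : nonarch_local_field) (K : separable_closure k).
Variable Phi : weil K.
Local Notation C := R[i].
Local Notation WD := (WD R K).
Implicit Types V W : rep C WD.

Lemma algebraic_tame n (f : sl2 C -> 'M[C]_n) i j :
  algebraic_mx f -> tame (fun g => f g i j).
Proof.
move=> /(_ i j) [P fP]; apply: (tame_ext (fun g => esym (fP g))).
under eq_fun do rewrite mpoly.mevalE.
apply: tame_sum => m; apply: tameM; first exact: tame_const.
apply: tame_prod => l; apply: tameX.
case/mxvec_indexP: l => a b.
by under eq_fun do rewrite mxvecE; exact: tame_entry.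
Qed.

(** What is kept of admissibility and boundedness: a condition on matrix coefficients that passes to
    direct summands and to [V] tensored with the dual of [W]. *)
Definition bounded_tame V : Prop :=
  (forall i j, norm_bounded (fun w : weil K => V (w, 1%g) i j)) /\
  (forall i j, tame (fun g => V (1%g, g) i j)).

Lemma bounded_tameP V : admissible V -> bounded V -> bounded_tame V.
Proof.
move=> [_ _ Va] [B VB]; split=> i j; last exact: algebraic_tame.
by exists B => [|w] //; rewrite (le_trans _ (VB 1%g i j)).
Qed.

Lemma bounded_tame_sub V W (P : 'M[C]_(rep_dim W, rep_dim V))
    (Q : 'M[C]_(rep_dim V, rep_dim W)) :
  (forall g, W g = P *m V g *m Q) -> bounded_tame V -> bounded_tame W.
Proof.
move=> WE [VB VT]; split=> i j; under eq_fun do rewrite WE mxE.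
  apply: norm_bounded_sum => a; apply: norm_boundedM;
    last exact: norm_bounded_const.
  under eq_fun do rewrite mxE; apply: norm_bounded_sum => b.
  exact: norm_boundedM (norm_bounded_const _ _) (VB _ _).
apply: tame_sum => a; apply: tameM; last exact: tame_const.
under eq_fun do rewrite mxE; apply: tame_sum => b.
exact: tameM (tame_const _) (VT _ _).
Qed.

Lemma bounded_tame_dsum V W U : rep_iso V (rep_dsum W U) -> bounded_tame V ->
  bounded_tame W /\ bounded_tame U.
Proof.
move=> [P [Q [PQ QP VP]]] Vb.
have E g : rep_dsum W U g = Q *m V g *m P.
  by rewrite -mulmxA VP mulmxA QP mul1mx.
split.
  apply: (@bounded_tame_sub V W (row_mx 1%:M 0 *m Q) (P *m col_mx 1%:M 0)) => // g.
  have -> : row_mx 1%:M 0 *m Q *m V g *m (P *m col_mx 1%:M 0) =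
    row_mx 1%:M 0 *m (Q *m V g *m P) *m col_mx 1%:M 0.
    by rewrite !mulmxA.
  rewrite -E /= mul_row_block mul_row_col.
  by rewrite !mulmx0 !mulmx1 ?mul0mx !addr0 mul1mx.
apply: (@bounded_tame_sub V U (row_mx 0 1%:M *m Q) (P *m col_mx 0 1%:M)) => // g.
have -> : row_mx 0 1%:M *m Q *m V g *m (P *m col_mx 0 1%:M) =
  row_mx 0 1%:M *m (Q *m V g *m P) *m col_mx 0 1%:M.
    by rewrite !mulmxA.
  rewrite -E /= mul_row_block mul_row_col.
by rewrite !mulmx0 !mulmx1 ?mul0mx !add0r mul1mx.
Qed.

Lemma bounded_tame_tens_dual V W :
  bounded_tame V -> bounded_tame W -> bounded_tame (rep_tens V (rep_dual W)).
Proof.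
move=> [VB VT] [WB WT]; split=> i j; under eq_fun do rewrite !mxE.
  apply: norm_boundedM => //.
  have [B B0 WBb] := WB (mxtens_unindex j).2 (mxtens_unindex i).2.
  by exists B => // w; have := WBb w^-1%g; rewrite -[1%g in X in X -> _]invg1.
apply: tameM => //.
have := tame_inv (WT (mxtens_unindex j).2 (mxtens_unindex i).2).
by apply: tame_ext => g; rewrite -[1%g in LHS]invg1.
Qed.

Lemma weil_sqrtnorm_norm (w : weil K) n : weil_deg w = - n%:Z
  -> `|weil_sqrtnorm R w| <= 1.
Proof.
move=> wn; rewrite /weil_sqrtnorm ger0_norm ?ler0c ?sqrtr_ge0// lecR.
rewrite -sqrtr1 ler_wsqrtr// /weil_norm wn -exprnN.
by rewrite invf_le1 ?exprn_gt0 ?exprn_ege1 ?ltr0n ?ler1n ?resq_gt0.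
Qed.

(* A vector fixed by the upper unipotent subgroup generates a vector valued
   polynomial on the lower triangular matrices which is, off the diagonal,
   bounded as [t] goes to 0; interpolation extends the bound to the torus. *)
Lemma unip_fixed_torus V (u : 'cV[C]_(rep_dim V)) i : bounded_tame V ->
  (forall x, V (1%g, unip x) *m u = u) ->
  exists2 B : C, 0 <= B & forall (t : C) (t0 : t != 0), `|t| <= 1 ->
    `|(V (1%g, torus t0) *m u) i 0| <= B.
Proof.
move=> [_ VT] uU.
have fT : tame (fun g => (V (1%g, g) *m u) i 0).
  under eq_fun do rewrite mxE; apply: tame_sum => j.
  exact: tameM (VT _ _) (tame_const _).
have [[d fd] fb] := fT; have [M M0 HM] := @poly0_bound C d 1 isT.
(* For [|t| <= 1] and the nodes [1, ..., d], the number [1 + d] bounds the entries of the matrix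
   [mx22 t (- j^-1) j 0] used below. *)
have [B B0 fB] := fb (1 + d%:R); exists (M * B) => [|t t0 t1];
  first by rewrite mulr_ge0.
have [p pd pE] := fd t t0.
have -> : torus t0 = low 0 t0 by apply: val_inj.
rewrite pE; apply: HM => // j /andP[j0 jd]; rewrite -pE.
have j0' : j%:R != 0 :> C by rewrite pnatr_eq0 -lt0n.
have mdet : \det (mx22 t (- (j%:R)^-1) j%:R 0) == 1.
  by rewrite det_mx22 mulr0 sub0r mulNr opprK mulVf.
(* The right factor fixes [u] and absorbs the entry [t^-1], which is unbounded as [t] goes to 0. *)
have -> : low j%:R t0 = (SL2 mdet * unip (t * j%:R)^-1)%g.
  apply: val_inj; apply: esym; apply: (etrans (mx22M _ _ _ _ _ _ _ _)) => /=.
  rewrite !mulr0 !mulr1 !addr0; congr mx22; rewrite invfM.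
    by rewrite mulrA divff// mul1r subrr.
  by rewrite mulrCA divff// mulr1.
have -> : ((1, SL2 mdet * unip (t * j%:R)^-1) : WD)%g =
   (((1, SL2 mdet) : WD) * ((1, unip (t * j%:R)^-1) : WD))%g.
  by congr pair; rewrite /= mulg1.
rewrite rep_mxM -mulmxA uU; apply: fB => a b; rewrite mxE.
have jd' : j%:R <= d%:R :> C by rewrite ler_nat; move: jd; rewrite add1n ltnS.
have d0 : 0 <= d%:R :> C by [].
have j1 : 1 <= j%:R :> C by rewrite ler1n.
case: (a == 0); case: (b == 0).
- by rewrite (le_trans t1)// lerDl.
- rewrite normrN normfV normr_nat (@le_trans _ _ 1)// ?lerDl//.
  by rewrite invf_le1// (lt_le_trans _ j1).
- by rewrite normr_nat (le_trans jd')// lerDr.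
- by rewrite normr0 addr_ge0.
Qed.

(** On an eigenvector [u] the powers of Frobenius give [x ^+ n *: u]. They also factor as a Weil
    group element, which acts boundedly, times a torus element with parameter of norm at most 1,
    whose effect on [u] is bounded by [unip_fixed_torus]. So [x ^+ n] would stay bounded. *)
Lemma frob_mult_gt1 (x : C) V : geometric_frobenius Phi -> bounded_tame V ->
  1 < x -> frob_mult Phi x V = 0%N.
Proof.
move=> PhiN1 Vb x1; apply/eqP; rewrite -leqn0 leqNgt; apply/negP.
move=> /frob_mult_gt0 [v [v0 vI vx]].
have [i vi0] : exists i, v 0 i != 0.
  by apply/existsP; rewrite -negb_forall; apply: contraNN v0 => /forallP v0;
     apply/eqP/rowP => j; rewrite mxE; apply/eqP.
pose u := v^T.
have uU y : V (1%g, unip y) *m u = u.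
  by rewrite -[V _]trmxK -trmx_mul vI.
have ux : V (Phi, weil_torus R Phi) *m u = x *: u.
  by rewrite -[V _]trmxK -trmx_mul vx linearZ.
have powE n : exists2 w : weil K, weil_deg w = - n%:Z &
    V (w, weil_torus R w) *m u = x ^+ n *: u.
  have [t1 tM] := @weil_torus_morph R k K.
  elim: n => [|n [w wn wu]].
    by exists 1%g => //; rewrite t1 expr0 scale1r (rep_mx1 V) mul1mx.
  exists (Phi * w)%g; first by rewrite /= PhiN1 wn; lia.
  have -> : (((Phi * w)%g, weil_torus R (Phi * w)%g) : WD) =
    (((Phi, weil_torus R Phi) : WD) * (w, weil_torus R w))%g.
    by rewrite tM.
  by rewrite rep_mxM -mulmxA wu -scalemxAr ux scalerA exprSr.
have x0 : 0 <= x by rewrite (le_trans ler01)// ltW.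
pose H j := projT1 (cid2 (unip_fixed_torus j Vb uU)).
have [[VB _] [{}H0 HB]] : bounded_tame V /\ (forall j, 0 <= H j) /\
    forall j (t : C) (t0 : t != 0), `|t| <= 1 ->
    `|(V (1%g, torus t0) *m u) j 0| <= H j.
  split=> //; rewrite /H; split=> j; first by case: cid2.
  by case: cid2.
pose B j := projT1 (cid2 (VB i j)).
have [B0 BB] : (forall j, 0 <= B j) /\ (forall j w, `|V (w, 1%g) i j| <= B j).
  by rewrite /B; split=> j; case: cid2.
have bnd n : x ^+ n * `|u i 0| <= \sum_j B j * H j.
  have [w wn wu] := powE n.
  have <- : `|x ^+ n * u i 0| = x ^+ n * `|u i 0|.
    by rewrite normrM ger0_norm ?exprn_ge0.
  have -> : x ^+ n * u i 0 = (x ^+ n *: u) i 0 by rewrite [RHS]mxE.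
  have -> : x ^+ n *: u = V (w, 1%g) *m (V (1%g, weil_torus R w) *m u).
    rewrite -wu mulmxA -rep_mxM; congr (V _ *m _).
    by congr pair; rewrite /= ?mulg1 ?mul1g.
  rewrite mxE (le_trans (ler_norm_sum _ _ _))// ler_sum// => j _.
  rewrite normrM ler_pM//; apply: HB; exact: weil_sqrtnorm_norm wn.
have ui0 : 0 < `|u i 0| by rewrite normr_gt0 [u i 0]mxE.
set S := \sum_j _ in bnd.
(* Bernoulli's inequality replaces geometric growth by linear growth, which already contradicts the
   bound. *)
have bnd2 n : n%:R * ((x - 1) * `|u i 0|) <= S.
  apply: le_trans (bnd n); rewrite mulrA ler_wpM2r ?(ltW ui0)//.
  have bern (y : C) : 0 <= y -> n%:R * y <= (1 + y) ^+ n.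
    move=> y0; elim: n => [|m IHm]; first by rewrite mul0r expr0.
    rewrite exprS mulrDl mul1r -natr1 mulrDl mul1r lerD//.
    by rewrite ler_peMr// exprn_ege1// lerDl.
  have := bern (x - 1); rewrite [1 + _]addrC subrK. by apply;
    rewrite subr_ge0 ltW.
have y0 : 0 < (x - 1) * `|u i 0| by rewrite mulr_gt0// subr_gt0.
set y := _ * _ in y0 bnd2.
have S0 : 0 <= S by rewrite (le_trans _ (bnd2 0%N))// mul0r.
(* The Archimedean property is that of [R]; the quotient is nonnegative, hence comes from [R]. *)
have /complex_realP [s sE] : S / y \is Num.real.
  by rewrite ger0_real// divr_ge0// ltW.
have := bnd2 (Num.bound `|s|); rewrite -ler_pdivlMr// sE.
apply/negP; rewrite lt_geF// -[ltRHS](rmorph_nat (real_complex R)) ltcR.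
by rewrite (le_lt_trans (ler_norm s))// archi_boundP.
Qed.

End Vanishing.

(** * Orders of poles of L-functions *)

Section ComplexExponential.
Variable R : realType.
Local Notation C := R[i].

Lemma is_derive0_near (f : R -> R) (df : R) : is_derive (0 : R) 1 f df ->
  forall e, 0 < e -> exists2 d, 0 < d &
    forall x, `|x| < d -> `|f x - f 0 - df * x| <= e * `|x|.
Proof.
move=> [fd fdE] e e0.
have fl : h^-1 *: ((f \o shift 0) (h *: (1 : R)) - f 0) @[h --> 0^'] --> df.
  by rewrite -fdE; exact: fd.
have /cvgrPdist_le /(_ e e0) := fl.
rewrite near_withinE => /nbhs_ballP [d /= d0 H]; exists d => // x xd.
have [->|x0] := eqVneq x 0; first by rewrite mulr0 subrr subr0 normr0 mulr0.
have := H x; rewrite /ball /= sub0r normrN => /(_ xd x0).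
rewrite addr0 /GRing.scale /= mulr1 => Hx.
have -> : f x - f 0 - df * x = - ((df - x^-1 * (f x - f 0)) * x).
  by rewrite mulrBl mulrAC mulVf// mul1r opprB.
by rewrite normrN normrM ler_wpM2r.
Qed.

Lemma cexpD (a b : C) : cexp (a + b) = cexp a * cexp b.
Proof.
case: a => a1 a2; case: b => b1 b2; rewrite /cexp /= expRD cosD sinD.
by apply/eqP; rewrite eq_complex /=; apply/andP; split; apply/eqP; ring.
Qed.

Lemma cexp0 : cexp 0 = 1 :> C.
Proof. by rewrite /cexp /= expR0 cos0 sin0 mulr1 mulr0. Qed.

Lemma cexp_real (x : R) : cexp x%:C%C = (expR x)%:C%C.
Proof. by rewrite /cexp /= cos0 sin0 mulr1 mulr0. Qed.

Lemma cexp_neq0 (a : C) : cexp a != 0.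
Proof.
apply/negP => /eqP a0; have := cexp0.
by rewrite -(subrr a) cexpD a0 mul0r => /esym/eqP; rewrite oner_eq0.
Qed.

Lemma norm_complex_le (a b : R) : `|(a +i* b)%C| <= (`|a| + `|b|)%:C%C.
Proof.
have -> : (a +i* b)%C = a%:C%C + 'i%C * b%:C%C.
  by rewrite -(complexE (a +i* b)%C).
rewrite (le_trans (ler_normD _ _))// rmorphD normrM.
have n1 (x : R) : `|x%:C%C| = `|x|%:C%C :> C.
  by rewrite normc_def /= expr0n addr0 sqrtr_sqr.
have -> : `|'i%C| = 1 :> C by rewrite normc_def /= expr0n expr1n add0r sqrtr1.
by rewrite mul1r !n1.
Qed.

Lemma cexp_near (e : R) : 0 < e -> exists2 d : R, 0 < d &
  forall z : C, `|z| < d%:C%C -> `|cexp z - 1 - z| <= e%:C%C * `|z|.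
Proof.
(* The errors below add up to at most [5 * c * |y| + c * |x|], hence to [6 * c] times the norm of
   [z]; [c <= 1] gives [expR x <= 2]. *)
move=> e0; pose c := Num.min 1 (e / 6).
have c0 : 0 < c by rewrite lt_min ltr01 divr_gt0.
have c1 : c <= 1 by rewrite ge_min lexx.
have [d1 d10 H1] := is_derive0_near (is_derive_expR 0) c0.
have [d2 d20 H2] := is_derive0_near (is_derive_cos 0) c0.
have [d3 d30 H3] := is_derive0_near (is_derive_sin 0) c0.
exists (Num.min (c / 2) (Num.min d1 (Num.min d2 d3))).
  by rewrite !lt_min d10 d20 d30 divr_gt0.
case=> x y zd.
have xz : `|x|%:C%C <= `|(x +i* y)%C| := normc_ge_Re (x +i* y)%C.
have yz : `|y|%:C%C <= `|(x +i* y)%C|.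
  by rewrite normc_def lecR -sqrtr_sqr ler_wsqrtr// lerDr sqr_ge0.
have := le_lt_trans xz zd; have := le_lt_trans yz zd.
rewrite !ltcR !lt_min => /and4P[yc y1 y2 y3] /and4P[xc x1 x2 x3].
have := H1 _ x1; have := H2 _ y2; have := H3 _ y3.
rewrite expR0 cos0 sin0 oppr0 !mul0r !mul1r !subr0 !addr0 => Hs Hc He.
have En : `|expR x - 1| <= c.
  rewrite -(subrK x (expR x - 1)) (le_trans (ler_normD _ _))//.
  by have := normr_ge0 x; nra.
have E2 : `|expR x| <= 2.
  rewrite -(subrK 1 (expR x)) (le_trans (ler_normD _ _))// normr1; lra.
have E : cexp (x +i* y)%C - 1 - (x +i* y)%C =
  ((expR x * (cos y - 1) + (expR x - 1 - x)) +i*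
   (expR x * (sin y - y) + (expR x - 1) * y))%C.
  by rewrite /cexp /=; apply/eqP; rewrite eq_complex /=; apply/andP; split;
    apply/eqP; ring.
rewrite E (le_trans (norm_complex_le _ _))//.
have B1 : `|expR x * (cos y - 1) + (expR x - 1 - x)| <= 2 * (c * `|y|) + c * `|x|.
  by rewrite (le_trans (ler_normD _ _))// lerD// normrM ler_pM.
have B2 : `|expR x * (sin y - y) + (expR x - 1) * y| <= 2 * (c * `|y|) + c * `|y|.
  by rewrite (le_trans (ler_normD _ _))// lerD// normrM ler_pM.
have ce : 6 * c <= e by rewrite mulrC -ler_pdivlMr// ge_min lexx orbT.
have [n nE] : exists n : R, `|(x +i* y)%C| = n%:C%C by rewrite normc_def; eexists.
move: xz yz; rewrite nE !lecR -rmorphM lecR => xn yn.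
have := normr_ge0 x; have := normr_ge0 y; nra.
Qed.

End ComplexExponential.

(** * Calculus of pole orders, and its application to a single L-function *)

Section PoleOrder.
Variable R : realType.
Local Notation C := R[i].
Implicit Types f g : C -> C.

Local Notation cvg0 f l := ((fun s : C^o => f s : C^o) @ (0 : C^o)^' --> (l : C^o)).

Lemma eq_cvg0 (f g : C^o -> C^o) (l : C^o) :
  f @ (0 : C^o)^' --> l -> (forall s, s != 0 -> f s = g s) ->
  g @ (0 : C^o)^' --> l.
Proof.
move=> + fg; apply: cvg_trans; apply: near_eq_cvg.
rewrite near_withinE; apply: nearW => s s0; exact: fg.
Qed.

Lemma pole_orderM f g (m n : int) : pole_order f 0 m -> pole_order g 0 n ->
  pole_order (fun s => f s * g s) 0 (m + n).
Proof.
move=> [l l0 fl] [l' l'0 gl]; exists (l * l'); first by rewrite mulf_neq0.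
apply: (eq_cvg0 (cvgM fl gl)) => s s0.
by rewrite /= subr0 expfzDr// mulrACA.
Qed.

Lemma pole_orderV f (m : int) : pole_order f 0 m ->
  pole_order (fun s => (f s)^-1) 0 (- m).
Proof.
move=> [l l0 fl]; exists l^-1; first by rewrite invr_eq0.
apply: (eq_cvg0 (cvgV l0 fl)) => s s0.
by rewrite /= subr0 invfM invr_expz.
Qed.

Lemma cvg0_horner (p : {poly C}) f (l : C) : cvg0 f l ->
  cvg0 (fun s => p.[f s]) p.[l].
Proof.
move=> fl; elim/poly_ind: p => [|p c IHp].
  by rewrite horner0; apply: (eq_cvg0 (cvg_cst (0 : C^o))) => s _;
    rewrite horner0.
rewrite hornerMXaddC.
apply: (eq_cvg0 (cvgD (cvgM IHp fl) (cvg_cst (c : C^o)))) => s _.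
by rewrite hornerMXaddC.
Qed.

Lemma cvg0_exp f (l : C) n : cvg0 f l -> cvg0 (fun s => f s ^+ n) (l ^+ n).
Proof.
move=> fl; have := @cvg0_horner 'X^n _ _ fl; rewrite hornerXn => /eq_cvg0.
by apply=> s _; rewrite hornerXn.
Qed.

Lemma cexp_cvg0 (a : C) : cvg0 (fun s => (cexp (s * a) - 1) / s) a.
Proof.
have [->|a0] := eqVneq a 0.
  apply: (eq_cvg0 (cvg_cst (0 : C^o))) => s _.
  by rewrite mulr0 cexp0 subrr mul0r.
have na0 : 0 < `|a| by rewrite normr_gt0.
apply/cvgrPdist_le => e e0.
(* The tolerance [e] lives in [R[i]], but being positive there it is real. *)
have [e' e'0 e'E] : exists2 e' : R, 0 < e' & e'%:C%C * `|a| = e.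
  have : 0 < e / `|a| by rewrite divr_gt0.
  case E : (e / _) => [x y]; rewrite ltcE /= => /andP[/eqP y0 x0].
  by exists x => //; rewrite -[e](divfK (lt0r_neq0 na0)) E y0.
have [d d0 Hd] := cexp_near e'0.
rewrite near_withinE; apply/nbhs_ballP; exists (d%:C%C / `|a|) => /=.
  by rewrite divr_gt0// ltcR.
move=> s; rewrite /ball /= sub0r normrN => sd s0.
have ns0 : 0 < `|s| by rewrite normr_gt0.
have := Hd (s * a); rewrite normrM -ltr_pdivlMr// => /(_ sd) H.
have -> : a - (cexp (s * a) - 1) / s = - ((cexp (s * a) - 1 - s * a) / s).
  by rewrite [in RHS]mulrBl [s * a / s]mulrAC divff// mul1r opprB.
by rewrite normrN normrM normfV ler_pdivrMr// (le_trans H)// mulrCA e'E mulrC.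
Qed.

Variables (k : nonarch_local_field) (K : separable_closure k).

(** Makes [ln q] nonzero. A single representative [r] would be congruent to both 0 and 1, forcing 1
    to have positive valuation. *)
Lemma resq_gt1 : (1 < resq k)%N.
Proof.
have := @lf_repsP k 0; rewrite /val_ge eqxx => /(_ isT).
have := @lf_repsP k 1; rewrite /val_ge lf_val1 lexx orbT => /(_ isT).
rewrite /resq; case: (lf_reps k) => [|r [|r' s]] //=; rewrite !addn0.
rewrite sub0r oppr_eq0 subr_eq0; case: eqVneq => [r1|r1] /=.
  rewrite -r1 oner_eq0 /=; have := @lf_valN1 k => ->.
  by [].
have [->|r0] := eqVneq r 0; first by rewrite subr0 lf_val1.
move=> v1 v2; exfalso.
have /(_ 1 (1 - r) r) := @lf_valD k.
rewrite /val_ge !subrK oner_eq0 lf_val1 subr_eq0 (negPf r1) (negPf r0) /=.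
move: v1 v2; case: (1 <= lf_val (1 - r)) => // _.
have -> : lf_val (- r) = lf_val r.
  by rewrite -mulN1r lf_valM ?oppr_eq0 ?oner_eq0// lf_valN1 add0r.
by case: (1 <= lf_val r) => // _ /(_ isT isT).
Qed.

Lemma q_powD (s t : C) : q_pow k (s + t) = q_pow k s * q_pow k t.
Proof. by rewrite /q_pow mulrDl cexpD. Qed.

Lemma q_pow_neq0 (s : C) : q_pow k s != 0.
Proof. exact: cexp_neq0. Qed.

Lemma q_powN (s : C) : q_pow k (- s) = (q_pow k s)^-1.
Proof.
apply: (mulIf (q_pow_neq0 s)); rewrite -q_powD addNr mulVf ?q_pow_neq0//.
by rewrite /q_pow mul0r cexp0.
Qed.

Lemma q_pow_cvg0 : cvg0 (fun s => q_pow k s) 1.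
Proof.
set a := (ln (resq k)%:R)%:C%C : C.
have id0 : cvg0 (fun s => s) 0 by apply: cvg_within.
suff : cvg0 (fun s => q_pow k s) (1 + 0 * a) by rewrite mul0r addr0.
apply: (eq_cvg0 (cvgD (cvg_cst (1 : C^o)) (cvgM id0 (@cexp_cvg0 a)))) => s s0 /=.
rewrite -[LHS]/(1 + s * ((cexp (s * a) - 1) / s)).
by rewrite mulrC divfK// addrC subrK.
Qed.

Lemma det_horner_char_poly n (D : 'M[C]_n) x :
  \det (x%:M - D) = (char_poly D).[x].
Proof.
rewrite -[RHS]/(horner_eval x _) -det_map_mx; congr (\det _).
apply/matrixP => i j; rewrite !mxE.
rewrite -[RHS]/(horner _ x) hornerD hornerN hornerC hornerMn.
by rewrite hornerX.
Qed.

(** With [x = q ^ t] and [z = x q ^ s], the inverse of the L-function is [z ^ (- n)] times the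
    characteristic polynomial at [z]. The latter is [g(z) (z - x) ^ m] with [g(x)] nonzero, and
    [z - x] has a simple zero at [s = 0]. *)
Lemma pole_order_L_function (Phi : weil K) (V : rep C (WD R K)) t :
  pole_order (fun s => L_function Phi V (s + t)) 0
    (frob_mult Phi (q_pow k t) V).
Proof.
rewrite /L_function /frob_mult; move: (conjmx _ _) => D.
move: (\rank _) D => n D; set x := q_pow k t.
rewrite -[Posz _]opprK; apply: pole_orderV.
have [m [g]] := multiplicity_XsubC (char_poly D) x.
rewrite monic_neq0 ?char_poly_monic//= => gx chiE.
have -> : mup x (char_poly D) = m.
  by rewrite chiE mupMr// mup_XsubCX eqxx.
pose a := (ln (resq k)%:R)%:C%C : C.
have a0 : a != 0.
  rewrite /a eq_complex /= eqxx andbT gt_eqF// ln_gt0//.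
  by rewrite ltr1n resq_gt1.
(* The leading coefficient: [x * a], with [a = ln q], is the limit of [(z - x) / s]. *)
exists (x^-1 ^+ n * (g.[x] * (x * a) ^+ m)).
  by rewrite !mulf_neq0 ?expf_neq0 ?invr_eq0 ?q_pow_neq0 ?mulf_neq0 ?q_pow_neq0.
have xq : cvg0 (fun s => x * q_pow k s) x.
  suff : cvg0 (fun s => x * q_pow k s) (x * 1) by rewrite mulr1.
  exact: (eq_cvg0 (cvgM (cvg_cst (x : C^o)) q_pow_cvg0)).
have xV : cvg0 (fun s => (x * q_pow k s)^-1) x^-1.
  by apply: (eq_cvg0 (cvgV (q_pow_neq0 t) xq)).
have xa : cvg0 (fun s => x * ((q_pow k s - 1) / s)) (x * a).
  exact: (eq_cvg0 (cvgM (cvg_cst (x : C^o)) (@cexp_cvg0 a))).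
apply: (eq_cvg0 (cvgM (@cvg0_exp _ _ n xV)
  (cvgM (@cvg0_horner g _ _ xq) (@cvg0_exp _ _ m xa)))) => s s0 /=.
have qE : q_pow k (- (s + t)) = (x * q_pow k s)^-1.
  by rewrite q_powN q_powD mulrC.
have z0 : x * q_pow k s != 0 by rewrite mulf_neq0 ?q_pow_neq0.
rewrite qE subr0; have [z zE] : exists z, z = x * q_pow k s by eexists.
rewrite -zE in z0 *.
have -> : 1%:M - z^-1 *: D = z^-1 *: (z%:M - D).
  by rewrite scalerBr scale_scalar_mx mulVf.
rewrite detZ det_horner_char_poly chiE hornerM horner_exp hornerXsubC.
have -> : x * ((q_pow k s - 1) / s) = (z - x) / s.
  by rewrite zE mulrA mulrBr mulr1.
rewrite expr_div_n -exprnN; ring.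
Qed.

End PoleOrder.

(** * Strings of weights *)

Section StringSums.
Implicit Types (f : int -> nat) (c : int).

(** The Laurent polynomial [[m] = x^(m-1) + ... + x^(1-m)] acting on [f] by translations: a sum over
    the [m] points of step 2 centered at [c]. *)
Definition string_sum m f c : nat := (\sum_(a < m) f (c - m%:Z + 1 +
  (2 * a)%:Z)%R)%N.

(** This and the next lemma split the top or bottom point off a string. The centers [c1], [c2] are
    free variables so that rewriting can impose the form that cancels later. *)
Lemma string_sumSr m f c c1 c2 : c1 = c - 1 -> c2 = c + m%:Z ->
  string_sum m.+1 f c = (string_sum m f c1 + f c2)%N.
Proof.
move=> -> ->; rewrite /string_sum big_ord_recr /=; congr (_ + f _)%N; last lia.
by apply: eq_bigr => a _; congr f; lia.
Qed.

Lemma string_sumSl m f c c1 c2 : c1 = c - m%:Z -> c2 = c + 1 ->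
  string_sum m.+1 f c = (f c1 + string_sum m f c2)%N.
Proof.
move=> -> ->; rewrite /string_sum big_ord_recl /=; congr (f _ + _)%N; first lia.
by apply: eq_bigr => a _; rewrite /bump /=; congr f; lia.
Qed.

(** The first [i] points of the left string are negative (all of them if [j <= i]); the others are
    the first [j - i] points of the right string. *)
Lemma string_sum_refl f j i : (forall c, c < 0 -> f c = 0%N) ->
  (string_sum j f (- 1 - i%:Z)%R <= string_sum j f (- 1 + i%:Z)%R)%N.
Proof.
move=> f0; have [ji|ij] := leqP j i.
  rewrite [X in (X <= _)%N]big1// => a _; apply: f0.
  by have := ltn_ord a; lia.
have sumE c : string_sum j f c =
    (\sum_(0 <= a < j) f (c - j%:Z + 1 + (2 * a)%:Z)%R)%N by rewrite big_mkord.
rewrite !sumE (big_cat_nat (leq0n i) (ltnW ij)) /=.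
rewrite big_nat_cond big1 ?add0n => [|a /andP[/andP[_ ai] _]]; last first.
  by apply: f0; lia.
rewrite (big_cat_nat (leq0n (j - i)) (leq_subr i j)) /=.
rewrite -{1}(add0n i) big_addn; apply: leq_trans (leq_addr _ _).
by apply: leq_sum => a _; rewrite eq_leq//; congr f; lia.
Qed.

(** Splitting one point off each outer string of length [i.+1] cancels all double sums. What remains
    compares two single strings with centers reflected about -1, up to one endpoint, and
    [string_sum_refl] applies. *)
Lemma string_sum2_le f m n m' n' : (forall c, c < 0 -> f c = 0%N) ->
  m = n.+1 \/ n = m.+1 -> m' = n'.+1 \/ n' = m'.+1 ->
  (string_sum m (string_sum m' f) (- 2)%R +
    string_sum n (string_sum n' f) (- 2)%R <=
   string_sum m (string_sum n' f) (- 1)%R +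
     string_sum n (string_sum m' f) (- 1)%R)%N.
Proof.
move=> f0; set c1 : int := - 1; set c2 : int := - 2.
have c12 : c2 + 1 = c1 by rewrite /c1 /c2; lia.
have c21 : c2 = c1 - 1 by rewrite /c1 /c2; lia.
have refl j i : (string_sum j f (c1 - i%:Z)%R <= string_sum j f (c1 + i%:Z)%R)%N.
  exact: string_sum_refl.
have same i j :
  (string_sum i (string_sum j f) c2 + string_sum i.+1 (string_sum j.+1 f) c2 <=
   string_sum i (string_sum j.+1 f) c1 + string_sum i.+1 (string_sum j f) c1)%N.
  rewrite (string_sumSl _ (erefl (c2 - i%:Z)) (esym c12)).
  rewrite (string_sumSr _ c21 (erefl (c1 + i%:Z))).
  have e1 : c1 - i%:Z = c2 - i%:Z + 1 by lia.
  (* The extra endpoint lies on the smaller side here, so it has to vanish: it sits at a negative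
     integer. *)
  rewrite (string_sumSl _ (erefl (c2 - i%:Z - j%:Z)) e1) f0;
    last by rewrite /c2; lia.
  by have := refl j i; lia.
have opposite i j :
  (string_sum i (string_sum j.+1 f) c2 + string_sum i.+1 (string_sum j f) c2 <=
   string_sum i (string_sum j f) c1 + string_sum i.+1 (string_sum j.+1 f) c1)%N.
  rewrite (string_sumSl _ (erefl (c2 - i%:Z)) (esym c12)).
  rewrite (string_sumSr _ c21 (erefl (c1 + i%:Z))).
  have e1 : c1 + i.+1%:Z = c1 + i%:Z + 1 by lia.
  rewrite (string_sumSl _ (erefl (c1 + i%:Z - j%:Z)) e1).
  have e2 : c2 - i%:Z = c1 - i.+1%:Z by lia.
  by rewrite e2; have := refl j i.+1; lia.
move=> [->|->] [->|->].
- by have := same n n'; lia.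
- by have := opposite n m'; lia.
- by have := opposite m n'; lia.
- by have := same m m'; lia.
Qed.

End StringSums.

(** * Pairings of strings *)

Section Weights.
Variables (R : realType) (k : nonarch_local_field) (K : separable_closure k).
Local Notation C := R[i].
Local Notation WD := (WD R K).
Implicit Types (V W : rep C WD) (f : rep C WD -> nat).

(** The character [|w|^(a/2)], trivial on [SL_2]; half powers of the norm become integral
    weights. *)
Program Definition norm_char (a : int) : mchar C WD :=
  @MChar _ _ (fun g : WD => weil_sqrtnorm R g.1 ^ a) _ _.
Next Obligation. by move=> a; rewrite /= weil_sqrtnorm1 exp1rz. Qed.
Next Obligation. by move=> a g h; rewrite /= weil_sqrtnormM expfzMl. Qed.

(** The value of [f] on the L-parameter of [V] tensored with the symmetric power of dimension [m];
    it is 0 for [m = 0]. *)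
Definition string_mult f V m : nat :=
  \sum_(a < m) f (rep_scale (norm_char (m%:Z - 1 - (2 * a)%:Z)) V).

Lemma sym_mx_torus d (t : C) (t0 : t != 0) :
  sym_mx d (torus t0) = diag_mx (\row_(j < d.+1) t ^ (d%:Z - (2 * j)%:Z)).
Proof.
apply/matrixP => i j; rewrite !mxE /sl2_lin /= !mxE /=.
rewrite scale0r addr0 polyC0 add0r -rmorphXn /= exprZn mul_polyC scalerA.
rewrite coefZ coefXn -(inj_eq val_inj) /=.
case: eqP => [->|_]; last by rewrite mulr0 mulr0n.
rewrite mulr1 mulr1n exprVn exprnN -[t ^+ (d - j)]/(t ^ (d - j)%N%:Z).
rewrite -expfzDr//; congr (_ ^ _).
by have := ltn_ord j; lia.
Qed.

Lemma L_param_boxtimes_sym (V : rep C WD) d :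
  rep_iso (L_param (rep_boxtimes V (rep_sym C d)))
    (rep_tens V (rep_diag d.+1 (fun a => norm_char (d%:Z - (2 * a)%:Z)))).
Proof.
apply: (@rep_iso_cast _ _ (L_param (rep_boxtimes V (rep_sym C d)))
  (rep_tens V (rep_diag d.+1 (fun a => norm_char (d%:Z - (2 * a)%:Z)))) (erefl _)) => g.
rewrite castmx_id /=; congr (_ *t _).
by rewrite sym_mx_torus.
Qed.

(** The range [d] may be enlarged at will because two parameters will need a common one. *)
Lemma additive_L_param (VA : rep C (WDA R K)) (M : nat -> rep C WD) :
  A_decomposition VA M ->
  exists d0, forall d, (d0 <= d)%N -> rep_dim (M d) = 0%N /\
    forall f, rep_additive f ->
      f (L_param VA) = (\sum_(i < d) string_mult f (M i) i.+1)%N.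
Proof.
move=> [_ [d0 [M0 VAE]]]; exists d0 => d dd; split=> [|f fA]; first exact: M0.
case: (fA) => fI fD.
have mult0 i : (d0 <= i)%N -> string_mult f (M i) i.+1 = 0%N.
  move=> di; rewrite /string_mult big1// => a _.
  by apply: rep_additive_dim0 => //=; exact: M0.
rewrite -(big_mkord xpredT (fun i => string_mult f (M i) i.+1)).
rewrite (big_cat_nat (leq0n d0) dd) /= [X in (_ + X)%N]big_nat_cond.
rewrite [X in (_ + X)%N]big1 ?addn0 => [|i /andP[/andP[/mult0]]//].
have LI : rep_iso (L_param VA)
    (rep_bigsum d0 (fun i => L_param (rep_boxtimes (M i) (rep_sym C i)))).
  have [P [Q [PQ QP PV]]] := VAE; exists P, Q; split=> // g.
  exact: PV.
rewrite (fI _ _ LI) rep_additive_bigsum// big_mkord; apply: eq_bigr => i _.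
rewrite (fI _ _ (L_param_boxtimes_sym _ _)) rep_additive_tens_diag//.
apply: eq_bigr => a _; congr (f (rep_scale (norm_char _) _)); lia.
Qed.

Lemma rep_scale_iso chi V W :
  rep_iso V W -> rep_iso (rep_scale chi V) (rep_scale chi W).
Proof.
move=> [P [Q [PQ QP PV]]]; exists P, Q; split=> // g /=.
by rewrite -scalemxAl PV scalemxAr.
Qed.

Lemma rep_scale_dsum (chi : mchar C WD) V W :
  rep_iso (rep_scale chi (rep_dsum V W))
          (rep_dsum (rep_scale chi V) (rep_scale chi W)).
Proof.
apply: (@rep_iso_cast _ _ (rep_scale chi (rep_dsum V W))
  (rep_dsum (rep_scale chi V) (rep_scale chi W)) (erefl _)) => g.
by rewrite castmx_id /= scale_block_mx !scaler0.
Qed.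

Lemma string_mult_iso f V W m : rep_additive f -> rep_iso V W ->
  string_mult f V m = string_mult f W m.
Proof.
by move=> [fI _] VW; apply: eq_bigr => a _; exact/fI/rep_scale_iso.
Qed.

Lemma string_mult_dsum f V W m : rep_additive f ->
  string_mult f (rep_dsum V W) m = (string_mult f V m + string_mult f W m)%N.
Proof.
move=> [fI fD]; rewrite -big_split; apply: eq_bigr => a _.
by rewrite (fI _ _ (rep_scale_dsum _ _ _)) fD.
Qed.

Lemma string_mult_dim0 f V m : rep_additive f -> rep_dim V = 0%N ->
  string_mult f V m = 0%N.
Proof.
by move=> fA V0; apply: big1 => a _; exact: rep_additive_dim0.
Qed.

(* The summands [X l] occur in the two parameters tensored with symmetric powers
   of dimensions [m l] and [n l], which differ by one. *)
Lemma relevant_pair_strings (MA NA : rep C (WDA R K)) : relevant_pair MA NA ->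
  exists (I : finType) (X : I -> rep C WD) (m n : I -> nat),
    [/\ forall l, bounded_tame (X l),
        forall l, m l = (n l).+1 \/ n l = (m l).+1,
        forall f, rep_additive f ->
          f (L_param MA) = (\sum_l string_mult f (X l) (m l))%N &
        forall f, rep_additive f ->
          f (L_param NA) = (\sum_l string_mult f (X l) (n l))%N].
Proof.
move=> [M [N [dM dN [Mp [Mm [Np [Nm [ME NE MN NM]]]]]]]].
have [dA HA] := additive_L_param dM; have [dB HB] := additive_L_param dN.
pose d := maxn dA dB.
have [Md0 fM] := HA d (leq_maxl _ _); have [Nd0 fN] := HB d (leq_maxr _ _).
have tameM i : bounded_tame (Mp i) /\ bounded_tame (Mm i).
  by have [+ _] := dM => /(_ i) [aM bM]; apply: bounded_tame_dsum (ME i) _;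
     exact: bounded_tameP.
have tameN i : bounded_tame (Np i) /\ bounded_tame (Nm i).
  by have [+ _] := dN => /(_ i) [aN bN]; apply: bounded_tame_dsum (NE i) _;
     exact: bounded_tameP.
(* [p i] is [Nm i] up to isomorphism, in a string of length [i] in [M] and [i + 1] in [N]; for
   [Mm i] the lengths are exchanged. The unconstrained [Nm 0] and [Mm 0] get length 0 on the other
   side. *)
pose p i := if i is j.+1 then Mp j else Nm 0%N.
exists ('I_d.+1 * bool)%type, (fun l : 'I_d.+1 * bool => if l.2 then p l.1 else Mm l.1).
exists (fun l : 'I_d.+1 * bool => if l.2 then l.1 : nat else l.1.+1).
exists (fun l : 'I_d.+1 * bool => if l.2 then l.1.+1 else l.1 : nat).
have split_sum (F : 'I_d.+1 * bool -> nat) :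
    (\sum_l F l = \sum_(i < d.+1) F (i, true) + \sum_(i < d.+1) F (i, false))%N.
  rewrite (eq_bigr (fun l => F (l.1, l.2))) => [|[]//].
  rewrite -(pair_bigA _ (fun i b => F (i, b))) -big_split /=.
  by apply: eq_bigr => i _; rewrite big_bool.
have multM f i j : rep_additive f ->
    string_mult f (M i) j = (string_mult f (Mp i) j + string_mult f (Mm i) j)%N.
  by move=> fA; rewrite (string_mult_iso _ fA (ME i)) string_mult_dsum.
have multN f i j : rep_additive f ->
    string_mult f (N i) j = (string_mult f (Np i) j + string_mult f (Nm i) j)%N.
  by move=> fA; rewrite (string_mult_iso _ fA (NE i)) string_mult_dsum.
have multp f i j : rep_additive f -> string_mult f (p i) j =
  string_mult f (Nm i) j.
  by move=> fA; case: i => [//|i]; rewrite (string_mult_iso _ fA (MN i)).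
have mult00 f V : string_mult f V 0 = 0%N by rewrite /string_mult big_ord0.
split=> [[[[|i] ?] []]|[i []]|f fA|f fA] /=.
- by have [] := tameN 0%N.
- by have [] := tameM 0%N.
- by have [] := tameM i.
- by have [] := tameM i.+1.
- by right.
- by left.
- rewrite split_sum /= big_ord_recl mult00 add0n [X in (_ + X)%N]big_ord_recr /=.
  (* The top term [Mm d] vanishes since [M d] is 0, so both halves of the sum run over [i < d]. *)
  have := string_mult_dim0 d.+1 fA Md0; rewrite multM// => /eqP.
  rewrite addn_eq0 => /andP[_ /eqP->]; rewrite addn0 -big_split (fM _ fA).
  by apply: eq_bigr => i _; rewrite multM.
- rewrite split_sum /= big_ord_recr [X in (_ + X)%N]big_ord_recl mult00 add0n /=.
  have := string_mult_dim0 d.+1 fA Nd0; rewrite multN// => /eqP.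
  rewrite addn_eq0 multp// => /andP[_ /eqP->]; rewrite addn0 -big_split (fN _ fA).
  apply: eq_bigr => i _; rewrite multN// multp// addnC.
  by rewrite (string_mult_iso _ fA (NM i)).
Qed.

End Weights.

(** * The pairing of two parameters and the order of the pole *)

Section OrderOfPole.
Variables (R : realType) (k : nonarch_local_field) (K : separable_closure k).
Variable Phi : weil K.
Hypothesis hPhi : geometric_frobenius Phi.
Local Notation C := R[i].
Local Notation WD := (WD R K).
Implicit Types V W : rep C WD.

Local Notation sigma := (weil_sqrtnorm R Phi).

(** Since [sigma] is [q^(-1/2)], this is the order of the pole at [s = - c / 2] of the L-function of
    [V] tensored with the dual of [W]. *)
Definition pairing V W (c : int) : nat :=
  frob_mult Phi (sigma ^ c) (rep_tens V (rep_dual W)).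

Lemma frob_mult_norm_char a c V :
  frob_mult Phi (sigma ^ c) (rep_scale (norm_char R K a) V) =
  frob_mult Phi (sigma ^ (c - a)) V.
Proof.
rewrite frob_mult_scale /=; last first.
  by move=> w y w0; rewrite /= /weil_sqrtnorm /weil_norm w0 expr0z sqrtr1 exp1rz.
have s0 : sigma != 0 := weil_sqrtnorm_neq0 R Phi.
have -> : sigma ^ c / sigma ^ a = sigma ^ (c - a) by rewrite expfzDr// invr_expz.
by [].
Qed.

Lemma pairing_scale a b V W c :
  pairing (rep_scale (norm_char R K a) V) (rep_scale (norm_char R K b) W) c =
  pairing V W (c - a + b).
Proof.
rewrite /pairing (frob_mult_iso _ _ (rep_tens_scalel _ _ _)) frob_mult_norm_char.
rewrite (frob_mult_iso _ _ (rep_tens_dual_scale _ _ _)).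
have scaleI : rep_iso
    (rep_scale (mchar_inv (norm_char R K b)) (rep_tens V (rep_dual W)))
    (rep_scale (norm_char R K (- b)) (rep_tens V (rep_dual W))).
  apply: (@rep_iso_cast _ _
    (rep_scale (mchar_inv (norm_char R K b)) (rep_tens V (rep_dual W)))
    (rep_scale (norm_char R K (- b)) (rep_tens V (rep_dual W))) (erefl _)) => g.
  by rewrite castmx_id /= invr_expz.
by rewrite (frob_mult_iso _ _ scaleI) frob_mult_norm_char opprK.
Qed.

Lemma pairing_strings (I : finType) (X : I -> rep C WD) (m n : I -> nat) V W c :
  (forall f, rep_additive f -> f V = (\sum_l string_mult f (X l) (m l))%N) ->
  (forall f, rep_additive f -> f W = (\sum_l string_mult f (X l) (n l))%N) ->
  pairing V W c = (\sum_l \sum_l'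
    string_sum (m l) (string_sum (n l') (pairing (X l) (X l'))) c)%N.
Proof.
move=> HV HW; have fA x := @frob_mult_additive R k K Phi x.
rewrite /pairing (HV _ (rep_additive_tensl (rep_dual W) (fA (sigma ^ c)))).
apply: eq_bigr => l _; rewrite exchange_big; apply: eq_bigr => a _.
rewrite (HW _ (rep_additive_tens_dual _ (fA (sigma ^ c)))).
(* Dualizing negates the weights of the second string, so its summation order is reversed to match
   [string_sum]. *)
apply: eq_bigr => l' _; rewrite /string_mult [LHS](reindex_inj rev_ord_inj).
apply: eq_bigr => b _.
rewrite -/(pairing _ _ _) pairing_scale; congr pairing.
by rewrite /=; have := ltn_ord b; lia.
Qed.

(** A negative power of [sigma] exceeds 1, which [frob_mult_gt1] excludes as an eigenvalue. *)
Lemma pairing_lt0 V W c : bounded_tame V -> bounded_tame W -> c < 0 ->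
  pairing V W c = 0%N.
Proof.
move=> Vb Wb c0; apply: frob_mult_gt1 => //; first exact: bounded_tame_tens_dual.
have s0 : sigma != 0 := weil_sqrtnorm_neq0 R Phi.
have s1 : 1 < sigma^-1.
  rewrite /weil_sqrtnorm /weil_norm hPhi -fmorphV ltcR -sqrtrV; last first.
    by rewrite invr_ge0 ler0n.
  by rewrite invrK -[ltLHS]sqrtr1 ltr_sqrt ?ltr1n ?resq_gt1// ltr0n resq_gt0.
case: c c0 => [//|n] _; rewrite NegzE -exprnN -exprVn.
by rewrite exprn_egt1.
Qed.

Lemma q_pow_sigma : q_pow k 2^-1 = sigma ^ (- 1)%R /\ q_pow k 1 = sigma ^ (- 2)%R.
Proof.
(* [x] is the positive square root of [q], in the form in which [q_pow] produces it. *)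
pose x := expR (2^-1 * ln (resq k)%:R : R); have x0 : 0 < x := expR_gt0 _.
have q0 : 0 < (resq k)%:R :> R by rewrite ltr0n resq_gt0.
have xE : (resq k)%:R = x ^+ 2.
  by rewrite -expRM_natl mulrA divff ?pnatr_eq0// mul1r lnK.
have sE : sigma = (x^-1)%:C%C.
  rewrite /weil_sqrtnorm /weil_norm hPhi xE -[_ ^ (-1)]/((x ^+ 2)^-1).
  by rewrite -exprVn sqrtr_sqr gtr0_norm ?invr_gt0.
have half : q_pow k 2^-1 = x%:C%C :> C.
  have -> : 2^-1 = (2^-1 : R)%:C%C :> C by rewrite fmorphV rmorph_nat.
  by rewrite /q_pow -rmorphM cexp_real.
have sV : sigma ^ (-1) = x%:C%C by rewrite sE -[LHS]/(_^-1) -fmorphV invrK.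
split; first by rewrite half sV.
have -> : 1 = 2^-1 + 2^-1 :> C by rewrite {1}[1]splitr !mul1r.
by rewrite q_powD half -sV -expfzDr ?weil_sqrtnorm_neq0.
Qed.

End OrderOfPole.

Theorem theorem3p2 (R : realType) (k : nonarch_local_field)
    (K : separable_closure k) (Phi : weil K) (hPhi : geometric_frobenius Phi)
    (m n : nat) (MA NA : rep R[i] (WDA R K))
    (hm : rep_dim MA = m) (hn : rep_dim NA = n)
    (hMA : A_param MA) (hNA : A_param NA) (hrel : relevant_pair MA NA) :
  exists r : int,
    pole_order (L_pair Phi (L_param MA) (L_param NA)) 0 r /\ 0 <= r.
Proof.
have [I [X [dM [dN [Xtame dMN HM HN]]]]] := relevant_pair_strings hrel.
pose M := L_param MA; pose N := L_param NA.
have [q1 q2] := q_pow_sigma R hPhi.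
have order1 (V W : rep R[i] (WD R K)) : pole_order
    (fun s => L_function Phi (rep_tens V (rep_dual W)) (s + 2^-1)) 0
    (pairing Phi V W (- 1)%R).
  by rewrite /pairing -q1; exact: pole_order_L_function.
have order2 (V W : rep R[i] (WD R K)) : pole_order
    (fun s => L_function Phi (rep_tens V (rep_dual W)) (s + 1)) 0
    (pairing Phi V W (- 2)%R).
  by rewrite /pairing -q2; exact: pole_order_L_function.
have order1' : pole_order
    (fun s => L_function Phi (rep_tens (rep_dual M) N) (s + 2^-1)) 0
    (pairing Phi N M (- 1)%R).
  (* The second numerator factor has its dual on the left; swapping the factors makes it a pairing
     of [N] with [M]. *)
  rewrite /pairing -q1 (frob_mult_iso _ _ (rep_tensC N (rep_dual M))).
  exact: pole_order_L_function.
exists ((pairing Phi M N (- 1)%R)%:Z + (pairing Phi N M (- 1)%R)%:Z -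
        ((pairing Phi M M (- 2)%R)%:Z + (pairing Phi N N (- 2)%R)%:Z)); split.
  exact: pole_orderM (pole_orderM (order1 M N) order1')
    (pole_orderV (pole_orderM (order2 M M) (order2 N N))).
rewrite subr_ge0 -!PoszD lez_nat.
rewrite (pairing_strings _ _ HM HN) (pairing_strings _ _ HN HM).
rewrite (pairing_strings _ _ HM HM) (pairing_strings _ _ HN HN).
(* All four pairings are now sums over the same pairs of strings, so the inequality may be checked
   for each pair separately. *)
rewrite -!big_split; apply: leq_sum => l _; rewrite -!big_split.
apply: leq_sum => l' _; apply: string_sum2_le => // c c0.
exact: pairing_lt0.
Qed.
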